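(* The adjoint functors $F:\mathrm{Ch}(H)\rightleftarrows\mathrm{Ch}(G):U$ given by $FM_\bullet=\mathbb{X}\otimes_HM_\bullet$ and $UV_\bullet=V_\bullet^I$ form a Quillen equivalence with respect to the $I$-projective model structure on $\mathrm{Ch}(G)$ and the projective model structure on $\mathrm{Ch}(H)$. In particular, the derived adjunction $$LF:D(H)\rightleftarrows\mathrm{Ho}(\mathrm{Ch}(G)):RU$$ is an equivalence between the unbounded derived category $D(H)$ of $\mathrm{Mod}(H)$ and the homotopy category of the $I$-projective model structure on $\mathrm{Ch}(G)$.
   Context: Let $k$ be a field of characteristic $p>0$ and $G$ a topological group (possibly discrete) admitting an open pro-$p$ subgroup $I$. $\mathrm{Rep}_k^\infty(G)$ is the category of smooth $k$-linear $G$-representations (stabilizers of vectors are open). $\mathbb{X}=\mathrm{ind}_I^G(k)$ is the space of compactly supported $f:G\to k$ with $f(gi)=f(g)$ for $i\in I$, with action $(gf)(g')=f(g^{-1}g')$; $H=\mathrm{End}_G(\mathbb{X})^{\mathrm{op}}$, so $\mathbb{X}$ is a right $H$-module and $V^I\cong\mathrm{Hom}_G(\mathbb{X},V)$ is a left $H$-module; $\mathrm{Mod}(H)$ is the category of left $H$-modules. $\mathrm{Ch}(H)$ and $\mathrm{Ch}(G)$ are the categories of unbounded chain complexes over $\mathrm{Mod}(H)$ and $\mathrm{Rep}^\infty_k(G)$. The projective model structure on $\mathrm{Ch}(H)$ has as fibrations the surjections and as weak equivalences the quasi-isomorphisms. The $I$-projective model structure on $\mathrm{Ch}(G)$ has as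 fibrations the chain maps $f$ with $Uf$ surjective, as weak equivalences the chain maps $f$ with $Uf$ a quasi-isomorphism, and as cofibrations the maps with the left lifting property with respect to all maps that are both fibrations and weak equivalences. *)

(* Defs.v *)
From HB Require Import structures.
From mathcomp Require Import all_boot all_order all_algebra.
From mathcomp Require Import all_classical.
From mathcomp Require Import topology.
From mathcomp Require Import generic_quotient.

Set Implicit Arguments.
Unset Strict Implicit.
Unset Printing Implicit Defensive.

Import GRing.Theory.

Declare Scope cat_scope.
Delimit Scope cat_scope with cat.
Local Open Scope cat_scope.

(* Morphisms are compared by the equivalence relation [heq], not by Leibniz
   equality, so that localizations need no quotient types. *)
Record category := Category {
  obj :> Type;
  hom : obj -> obj -> Type;
  heq : forall a b, hom a b -> hom a b -> Prop;
  idm : forall a, hom a a;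
  compm : forall a b c, hom b c -> hom a b -> hom a c;
  heq_refl : forall a b (f : hom a b), heq f f;
  heq_sym : forall a b (f g : hom a b), heq f g -> heq g f;
  heq_trans : forall a b (f g h : hom a b), heq f g -> heq g h -> heq f h;
  compm_heq : forall a b c (g g' : hom b c) (f f' : hom a b),
    heq g g' -> heq f f' -> heq (compm g f) (compm g' f');
  compm1 : forall a b (f : hom a b), heq (compm f (idm a)) f;
  comp1m : forall a b (f : hom a b), heq (compm (idm b) f) f;
  compmA : forall a b c d (h : hom c d) (g : hom b c) (f : hom a b),
    heq (compm h (compm g f)) (compm (compm h g) f) }.

Arguments hom {_} _ _.
Arguments heq {_ _ _} _ _.
Arguments idm {_} _.
Arguments compm {_ _ _ _} _ _.

Notation "f ~= g" := (heq f g) (at level 70, no associativity) : cat_scope.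
Notation "g \oc f" := (compm g f) (at level 40, left associativity) : cat_scope.

Definition is_iso (C : category) (a b : C) (f : hom a b) : Prop :=
  exists g : hom b a, g \oc f ~= idm a /\ f \oc g ~= idm b.

Definition is_initial (C : category) (o : C) : Prop :=
  forall x : C, exists f : hom o x, forall g : hom o x, g ~= f.

Definition is_terminal (C : category) (o : C) : Prop :=
  forall x : C, exists f : hom x o, forall g : hom x o, g ~= f.

Record functor (C D : category) := Functor {
  fobj :> C -> D;
  fmap : forall a b, hom a b -> hom (fobj a) (fobj b);
  fmap_heq : forall a b (f g : hom a b), f ~= g -> fmap f ~= fmap g;
  fmap1 : forall a, fmap (idm a) ~= idm (fobj a);
  fmapM : forall a b c (g : hom b c) (f : hom a b),
    fmap (g \oc f) ~= fmap g \oc fmap f }.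

Arguments fmap {C D} F {a b} f : rename.

Section FunctorComp.
Variables (C D E : category) (G : functor D E) (F : functor C D).

Lemma fcomp_heq a b (f g : hom a b) :
  f ~= g -> fmap G (fmap F f) ~= fmap G (fmap F g).
Proof. by move=> fg; do 2!apply: fmap_heq. Qed.

Lemma fcomp1 a : fmap G (fmap F (idm a)) ~= idm (G (F a)).
Proof. exact: heq_trans (fmap_heq _ (fmap1 F a)) (fmap1 G _). Qed.

Lemma fcompM a b c (g : hom b c) (f : hom a b) :
  fmap G (fmap F (g \oc f)) ~= fmap G (fmap F g) \oc fmap G (fmap F f).
Proof. exact: heq_trans (fmap_heq _ (fmapM F g f)) (fmapM G _ _). Qed.

Definition fcomp : functor C E :=
  @Functor C E (fun a => G (F a)) (fun a b f => fmap G (fmap F f))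
    fcomp_heq fcomp1 fcompM.

End FunctorComp.

Notation "G \of F" := (fcomp G F) (at level 40, left associativity) : cat_scope.

Record nat_trans (C D : category) (F G : functor C D) := NatTrans {
  component :> forall x, hom (F x) (G x);
  naturality : forall x y (f : hom x y),
    component y \oc fmap F f ~= fmap G f \oc component x }.

Record adjunction (C D : category) (F : functor C D) (U : functor D C) :=
  Adjunction {
    unit_ : forall x : C, hom x (U (F x));
    counit_ : forall y : D, hom (F (U y)) y;
    unit_nat : forall x y (f : hom x y),
      unit_ y \oc f ~= fmap U (fmap F f) \oc unit_ x;
    counit_nat : forall x y (f : hom x y),
      counit_ y \oc fmap F (fmap U f) ~= f \oc counit_ x;
    triangle_left : forall x, counit_ (F x) \oc fmap F (unit_ x) ~= idm (F x);
    triangle_right : forall y, fmap U (counit_ y) \oc unit_ (U y) ~= idm (U y) }.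

Definition is_equivalence (C D : category) (F : functor C D) (U : functor D C)
    (adj : adjunction F U) : Prop :=
  (forall x, is_iso (unit_ adj x)) /\ (forall y, is_iso (counit_ adj y)).

Definition mor_class (C : category) := forall a b : C, hom a b -> Prop.

Section Models.
Variable C : category.
Implicit Types W : mor_class C.

Definition has_lifting (a b x y : C) (i : hom a b) (q : hom x y) : Prop :=
  forall (u : hom a x) (v : hom b y), q \oc u ~= v \oc i ->
    exists h : hom b x, h \oc i ~= u /\ q \oc h ~= v.

Definition is_retract (a b x y : C) (f : hom a b) (g : hom x y) : Prop :=
  exists (s : hom a x) (r : hom x a) (s' : hom b y) (r' : hom y b),
    [/\ r \oc s ~= idm a, r' \oc s' ~= idm b,
        g \oc s ~= s' \oc f & f \oc r ~= r' \oc g].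

Definition is_subcategory W : Prop :=
  [/\ forall a b (f g : hom a b), f ~= g -> W _ _ f -> W _ _ g,
      forall a, W _ _ (idm a) &
      forall a b c (g : hom b c) (f : hom a b),
        W _ _ g -> W _ _ f -> W _ _ (g \oc f)].

Definition retract_closed W : Prop :=
  forall a b x y (f : hom a b) (g : hom x y),
    is_retract f g -> W _ _ g -> W _ _ f.

Definition two_of_three W : Prop :=
  forall a b c (g : hom b c) (f : hom a b),
    [/\ W _ _ f -> W _ _ g -> W _ _ (g \oc f),
        W _ _ f -> W _ _ (g \oc f) -> W _ _ g &
        W _ _ g -> W _ _ (g \oc f) -> W _ _ f].

Record model := Model {
  weq : mor_class C;
  fib : mor_class C;
  cof : mor_class C }.

Definition triv_fib (M : model) : mor_class C :=
  fun a b f => fib M f /\ weq M f.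

Definition triv_cof (M : model) : mor_class C :=
  fun a b f => cof M f /\ weq M f.

(* factorizations are not required to be functorial *)
Record is_model_structure (M : model) : Prop := {
  ms_weq_sub : is_subcategory (weq M);
  ms_fib_sub : is_subcategory (fib M);
  ms_cof_sub : is_subcategory (cof M);
  ms_two_of_three : two_of_three (weq M);
  ms_weq_retract : retract_closed (weq M);
  ms_fib_retract : retract_closed (fib M);
  ms_cof_retract : retract_closed (cof M);
  ms_lift_cof : forall a b x y (i : hom a b) (q : hom x y),
    cof M i -> triv_fib M q -> has_lifting i q;
  ms_lift_triv_cof : forall a b x y (i : hom a b) (q : hom x y),
    triv_cof M i -> fib M q -> has_lifting i q;
  ms_factor_cof : forall a b (f : hom a b),
    exists (z : C) (i : hom a z) (q : hom z b),
      [/\ cof M i, triv_fib M q & q \oc i ~= f];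
  ms_factor_triv_cof : forall a b (f : hom a b),
    exists (z : C) (i : hom a z) (q : hom z b),
      [/\ triv_cof M i, fib M q & q \oc i ~= f] }.

(* the model with given weak equivalences and fibrations, in which the
   cofibrations are forced by the left lifting property *)
Definition model_of_fib (W Fb : mor_class C) : model :=
  Model W Fb (fun a b i => forall (x y : C) (q : hom x y),
    Fb _ _ q -> W _ _ q -> has_lifting i q).

Definition cofibrant (M : model) (x : C) : Prop :=
  exists (o : C) (i : hom o x), is_initial o /\ cof M i.

Definition fibrant (M : model) (x : C) : Prop :=
  exists (o : C) (q : hom x o), is_terminal o /\ fib M q.

End Models.

Section Quillen.
Variables (C D : category) (MC : model C) (MD : model D).
Variables (F : functor C D) (U : functor D C) (adj : adjunction F U).

Record is_quillen_adjunction : Prop := {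
  qa_source : is_model_structure MC;
  qa_target : is_model_structure MD;
  qa_cof : forall a b (f : hom a b), cof MC f -> cof MD (fmap F f);
  qa_triv_cof : forall a b (f : hom a b),
    triv_cof MC f -> triv_cof MD (fmap F f) }.

Record is_quillen_equivalence : Prop := {
  qe_adjunction : is_quillen_adjunction;
  qe_weq : forall (x : C) (y : D) (f : hom (F x) y),
    cofibrant MC x -> fibrant MD y ->
    (weq MD f <-> weq MC (fmap U f \oc unit_ adj x)) }.

End Quillen.

Section Localization.
Variables (C : category) (W : mor_class C).

(* formal composites of morphisms of [C] and of formal inverses of the elements
   of [W], modulo the congruence [loc_eq] *)
Inductive loc_hom : C -> C -> Type :=
| loc_mor a b : hom a b -> loc_hom a b
| loc_inv a b (w : hom a b) : W w -> loc_hom b a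
| loc_comp a b c : loc_hom b c -> loc_hom a b -> loc_hom a c.

Inductive loc_eq : forall a b, loc_hom a b -> loc_hom a b -> Prop :=
| loc_refl a b (f : loc_hom a b) : loc_eq f f
| loc_sym a b (f g : loc_hom a b) : loc_eq f g -> loc_eq g f
| loc_trans a b (f g h : loc_hom a b) : loc_eq f g -> loc_eq g h -> loc_eq f h
| loc_comp_eq a b c (g g' : loc_hom b c) (f f' : loc_hom a b) :
    loc_eq g g' -> loc_eq f f' -> loc_eq (loc_comp g f) (loc_comp g' f')
| loc_comp1 a b (f : loc_hom a b) : loc_eq (loc_comp f (loc_mor (idm a))) f
| loc_1comp a b (f : loc_hom a b) : loc_eq (loc_comp (loc_mor (idm b)) f) f
| loc_compA a b c d (h : loc_hom c d) (g : loc_hom b c) (f : loc_hom a b) :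
    loc_eq (loc_comp h (loc_comp g f)) (loc_comp (loc_comp h g) f)
| loc_mor_eq a b (f g : hom a b) : f ~= g -> loc_eq (loc_mor f) (loc_mor g)
| loc_mor_comp a b c (g : hom b c) (f : hom a b) :
    loc_eq (loc_mor (g \oc f)) (loc_comp (loc_mor g) (loc_mor f))
| loc_invl a b (w : hom a b) (Ww : W w) :
    loc_eq (loc_comp (loc_inv Ww) (loc_mor w)) (loc_mor (idm a))
| loc_invr a b (w : hom a b) (Ww : W w) :
    loc_eq (loc_comp (loc_mor w) (loc_inv Ww)) (loc_mor (idm b)).

Definition localization : category :=
  @Category C loc_hom loc_eq (fun a => loc_mor (idm a)) loc_comp
    loc_refl loc_sym loc_trans loc_comp_eq loc_comp1 loc_1comp loc_compA.

Definition loc_functor : functor C localization :=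
  @Functor C localization id loc_mor loc_mor_eq (fun a => loc_refl _)
    loc_mor_comp.

End Localization.

Definition Ho (C : category) (M : model C) : category := localization (weq M).

Section Derived.
Variables (C D : category) (MC : model C) (MD : model D).

Notation locC := (loc_functor (weq MC)).
Notation locD := (loc_functor (weq MD)).

(* Total left derived functors are terminal among the pairs [(T, mu)] with
   [mu : T \of locC -> locD \of F], total right derived functors are initial
   among the pairs [(T, mu)] with [mu : locC \of U -> T \of locD]. *)
Definition is_left_derived (F : functor C D) (LF : functor (Ho MC) (Ho MD))
    (lam : nat_trans (LF \of locC) (locD \of F)) : Prop :=
  forall (T : functor (Ho MC) (Ho MD))
    (mu : nat_trans (T \of locC) (locD \of F)),
  exists th : nat_trans T LF,
    (forall x : C, lam x \oc th x ~= mu x) /\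
    (forall th' : nat_trans T LF,
       (forall x : C, lam x \oc th' x ~= mu x) -> forall x, th' x ~= th x).

Definition is_right_derived (U : functor D C) (RU : functor (Ho MD) (Ho MC))
    (rho : nat_trans (locC \of U) (RU \of locD)) : Prop :=
  forall (T : functor (Ho MD) (Ho MC))
    (mu : nat_trans (locC \of U) (T \of locD)),
  exists th : nat_trans RU T,
    (forall y : D, th y \oc rho y ~= mu y) /\
    (forall th' : nat_trans RU T,
       (forall y : D, th' y \oc rho y ~= mu y) -> forall y, th' y ~= th y).

(* The last two fields say that the unit and the counit of the adjunction
   between the derived functors are those induced by [adj]. *)
Record derived_adjunction (F : functor C D) (U : functor D C)
    (adj : adjunction F U) := DerivedAdjunction {
  LF : functor (Ho MC) (Ho MD);
  LF_trans : nat_trans (LF \of locC) (locD \of F);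
  LF_derived : is_left_derived LF_trans;
  RU : functor (Ho MD) (Ho MC);
  RU_trans : nat_trans (locC \of U) (RU \of locD);
  RU_derived : is_right_derived RU_trans;
  LF_RU_adj : adjunction LF RU;
  derived_unit : forall x : C,
    fmap RU (LF_trans x) \oc unit_ LF_RU_adj x ~=
    RU_trans (F x) \oc fmap locC (unit_ adj x);
  derived_counit : forall y : D,
    counit_ LF_RU_adj y \oc fmap LF (RU_trans y) ~=
    fmap locD (counit_ adj y) \oc LF_trans (U y) }.

End Derived.

(* categories with zero morphisms: enough structure to speak of complexes *)
Record zcategory := ZCategory {
  zcat :> category;
  zerom : forall a b : zcat, hom a b;
  comp0m : forall (a b c : zcat) (f : hom a b),
    zerom b c \oc f ~= zerom a c;
  compm0 : forall (a b c : zcat) (g : hom b c),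
    g \oc zerom a b ~= zerom a c }.

Arguments zerom {_} _ _.

Record zfunctor (C D : zcategory) := ZFunctor {
  zfun :> functor C D;
  zfun0 : forall a b : C, fmap zfun (zerom a b) ~= zerom (zfun a) (zfun b) }.

Section Complexes.
Variable C : zcategory.

Local Open Scope ring_scope.

Record complex := Complex {
  cx_obj :> int -> C;
  cx_d : forall n, hom (cx_obj (n + 1)) (cx_obj n);
  cx_dd : forall n, cx_d n \oc cx_d (n + 1) ~= zerom _ _ }.

Record chain_map (A B : complex) := ChainMap {
  chain :> forall n, hom (A n) (B n);
  chain_d : forall n, cx_d B n \oc chain (n + 1) ~= chain n \oc cx_d A n }.

Definition chain_eq (A B : complex) (f g : chain_map A B) : Prop :=
  forall n, f n ~= g n.

Lemma chain_id_d (A : complex) n :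
  cx_d A n \oc idm (A (n + 1)) ~= idm (A n) \oc cx_d A n.
Proof. exact: heq_trans (compm1 _) (heq_sym (comp1m _)). Qed.

Definition chain_id (A : complex) : chain_map A A := ChainMap (@chain_id_d A).

Lemma chain_comp_d (A B E : complex) (g : chain_map B E) (f : chain_map A B) n :
  cx_d E n \oc (g (n + 1) \oc f (n + 1)) ~= (g n \oc f n) \oc cx_d A n.
Proof.
apply: heq_trans (compmA _ _ _) _.
apply: heq_trans (compm_heq (chain_d g n) (heq_refl _)) _.
apply: heq_trans (heq_sym (compmA _ _ _)) _.
apply: heq_trans (compm_heq (heq_refl _) (chain_d f n)) _.
exact: compmA.
Qed.

Definition chain_comp (A B E : complex) (g : chain_map B E) (f : chain_map A B) :
  chain_map A E := ChainMap (chain_comp_d g f).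

Definition Ch : category.
refine (@Category complex chain_map chain_eq chain_id chain_comp _ _ _ _ _ _ _).
- by move=> A B f n; apply: heq_refl.
- by move=> A B f g fg n; apply: heq_sym.
- by move=> A B f g h fg gh n; apply: heq_trans (fg n) (gh n).
- by move=> A B E g g' f f' gg ff n; apply: compm_heq.
- by move=> A B f n; apply: compm1.
- by move=> A B f n; apply: comp1m.
- by move=> A B E K h g f n; apply: compmA.
Defined.

End Complexes.

Section ChFunctor.
Variables (C D : zcategory) (F : zfunctor C D).

Local Open Scope ring_scope.

Lemma Ch_obj_dd (A : Ch C) n :
  fmap F (cx_d A n) \oc fmap F (cx_d A (n + 1)) ~= zerom _ _.
Proof.
apply: heq_trans (heq_sym (fmapM _ _ _)) _.
exact: heq_trans (fmap_heq _ (cx_dd A n)) (zfun0 F _ _).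
Qed.

Definition Ch_obj (A : Ch C) : Ch D := Complex (Ch_obj_dd A).

Lemma Ch_map_d (A B : Ch C) (f : hom A B) n :
  fmap F (cx_d B n) \oc fmap F (chain f (n + 1)) ~=
  fmap F (chain f n) \oc fmap F (cx_d A n).
Proof.
apply: heq_trans (heq_sym (fmapM _ _ _)) _.
exact: heq_trans (fmap_heq _ (chain_d f n)) (fmapM _ _ _).
Qed.

Definition Ch_map (A B : Ch C) (f : hom A B) : hom (Ch_obj A) (Ch_obj B) :=
  @ChainMap D (Ch_obj A) (Ch_obj B) (fun n => fmap F (chain f n)) (Ch_map_d f).

Definition Ch_functor : functor (Ch C) (Ch D).
refine (@Functor (Ch C) (Ch D) Ch_obj Ch_map _ _ _).
- by move=> A B f g fg n; apply: fmap_heq (fg n).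
- by move=> A n; apply: fmap1.
- by move=> A B E g f n; apply: fmapM.
Defined.

End ChFunctor.

Section ChAdjunction.
Variables (C D : zcategory) (F : zfunctor C D) (U : zfunctor D C).
Variable adj : adjunction F U.

Definition Ch_unit (A : Ch C) : hom A (Ch_functor U (Ch_functor F A)) :=
  @ChainMap C A (Ch_functor U (Ch_functor F A)) (fun n => unit_ adj (A n))
    (fun n => heq_sym (unit_nat adj (cx_d A n))).

Definition Ch_counit (B : Ch D) : hom (Ch_functor F (Ch_functor U B)) B :=
  @ChainMap D (Ch_functor F (Ch_functor U B)) B (fun n => counit_ adj (B n))
    (fun n => heq_sym (counit_nat adj (cx_d B n))).

Definition Ch_adjunction : adjunction (Ch_functor F) (Ch_functor U).
refine (@Adjunction _ _ (Ch_functor F) (Ch_functor U) Ch_unit Ch_counit _ _ _ _).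
- by move=> A B f n; apply: unit_nat.
- by move=> A B f n; apply: counit_nat.
- by move=> A n; apply: triangle_left.
- by move=> A n; apply: triangle_right.
Defined.

End ChAdjunction.

Local Open Scope classical_set_scope.
Local Open Scope card_scope.
Local Open Scope ring_scope.

HB.mixin Record isTopologicalGroup G of Topological G & Group G := {
  mulg_continuous : continuous (fun xy : G * G => (xy.1 * xy.2)%g);
  invg_continuous : continuous (fun x : G => (x^-1)%g) }.

#[short(type="topGroupType")]
HB.structure Definition TopologicalGroup :=
  {G of Topological G & Group G & isTopologicalGroup G}.

Section Subgroups.
Variable G : topGroupType.
Implicit Types A N : set G.

Definition is_subgroup A : Prop :=
  [/\ A 1%g, forall x y, A x -> A y -> A (x * y)%g &
      forall x, A x -> A (x^-1)%g].

Definition is_normal_in N A : Prop :=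
  forall a x, A a -> N x -> N (a^-1 * x * a)%g.

Definition is_open_in N A : Prop := exists2 U, open U & N = U `&` A.

Definition left_coset (x : G) N : set G := [set y | N (x^-1 * y)%g].

(* a profinite group, all of whose open normal subgroups have [p]-power index;
   [subspace A] adds to [A] only isolated points, so it is Hausdorff iff [A] is *)
Definition is_pro_p (p : nat) A : Prop :=
  [/\ is_subgroup A, compact A, hausdorff_space (subspace A),
      totally_disconnected A &
      forall N, is_subgroup N -> N `<=` A -> is_normal_in N A ->
        is_open_in N A ->
        exists n, [set left_coset x N | x in A] #= `I_(p ^ n)].

Lemma mulgl_continuous (a : G) : continuous (fun x : G => (a * x)%g).
Proof.
move=> x B nB; have := @mulg_continuous G (a, x) B nB.
move=> [[P Q] /= [Pa Qx] PQB]; apply: filterS Qx => y Qy.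
by apply: (PQB (a, y)); split=> //=; exact: nbhs_singleton Pa.
Qed.

Lemma open_subgroup A : is_subgroup A -> nbhs 1%g A -> open A.
Proof.
case=> A1 AM AV nA; rewrite openE => a Aa.
have h : nbhs (a^-1 * a)%g A by rewrite mulVg.
have {}h : nbhs a [set x | A (a^-1 * x)%g] := mulgl_continuous h.
suff : nbhs a A by [].
by apply: filterS h => x /= Ax; rewrite -[x](mulVKg a); exact: AM.
Qed.

End Subgroups.

Record open_pro_p_subgroup (p : nat) (G : topGroupType) := OpenProP {
  ops_set :> set G;
  ops_open : open ops_set;
  ops_pro_p : is_pro_p p ops_set }.

Section SmoothReps.
Variables (k : fieldType) (G : topGroupType).

Record smooth_rep := SmoothRep {
  rep_mod :> lmodType k;
  act : G -> rep_mod -> rep_mod;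
  act_linear : forall g, linear (act g);
  act1 : forall v, act 1%g v = v;
  actM : forall g h v, act (g * h)%g v = act g (act h v);
  act_smooth : forall v, open [set g | act g v = v] }.

HB.instance Definition _ (V : smooth_rep) (g : G) :=
  GRing.isLinear.Build k V V _ (@act V g) (@act_linear V g).

Record rep_hom (V W : smooth_rep) := RepHom {
  rep_fun :> V -> W;
  rep_linear : linear rep_fun;
  rep_equiv : forall g v, rep_fun (act g v) = act g (rep_fun v) }.

HB.instance Definition _ (V W : smooth_rep) (f : rep_hom V W) :=
  GRing.isLinear.Build k V W _ (rep_fun f) (@rep_linear _ _ f).

Lemma rep_hom_ext (V W : smooth_rep) (f g : rep_hom V W) : f =1 g -> f = g.
Proof.
case: f g => [f fl fe] [g gl ge] /= /funext E; subst g.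
by congr RepHom; exact: Prop_irrelevance.
Qed.

Lemma rep_id_equiv (V : smooth_rep) g (v : V) : idfun (act g v) = act g (idfun v).
Proof. by []. Qed.

Definition rep_id (V : smooth_rep) : rep_hom V V :=
  RepHom (@linearP _ _ _ _ (idfun : {linear V -> V})) (@rep_id_equiv V).

Lemma rep_comp_equiv (V W Z : smooth_rep) (f : rep_hom W Z) (h : rep_hom V W) g v :
  (f \o h) (act g v) = act g ((f \o h) v).
Proof. by rewrite /= !rep_equiv. Qed.

Definition rep_comp (V W Z : smooth_rep) (f : rep_hom W Z) (h : rep_hom V W) :
  rep_hom V Z :=
  RepHom (@linearP _ _ _ _ (f \o h : {linear V -> Z})) (rep_comp_equiv f h).

Lemma rep_zero_equiv (V W : smooth_rep) g (v : V) :
  (\0 : {linear V -> W}) (act g v) = act g ((\0 : {linear V -> W}) v).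
Proof. by rewrite /= linear0. Qed.

Definition rep_zero (V W : smooth_rep) : rep_hom V W :=
  RepHom (@linearP _ _ _ _ (\0 : {linear V -> W})) (@rep_zero_equiv V W).

Lemma rep_add_equiv (V W : smooth_rep) (f h : rep_hom V W) g v :
  (f \+ h) (act g v) = act g ((f \+ h) v).
Proof. by rewrite /= !rep_equiv [RHS]linearD. Qed.

Definition rep_add (V W : smooth_rep) (f h : rep_hom V W) : rep_hom V W :=
  RepHom (@linearP _ _ _ _ (f \+ h : {linear V -> W})) (rep_add_equiv f h).

Lemma rep_opp_equiv (V W : smooth_rep) (f : rep_hom V W) g v :
  (\- f) (act g v) = act g ((\- f) v).
Proof. by rewrite /= !rep_equiv [RHS]linearN. Qed.

Definition rep_opp (V W : smooth_rep) (f : rep_hom V W) : rep_hom V W :=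
  RepHom (@linearP _ _ _ _ (\- f : {linear V -> W})) (rep_opp_equiv f).

Definition Rep_cat : category.
refine (@Category smooth_rep rep_hom (fun V W f g => f =1 g) rep_id rep_comp
  _ _ _ _ _ _ _) => //.
- by move=> V W f g fg v; rewrite fg.
- by move=> V W f g h fg gh v; rewrite fg gh.
- by move=> V W Z g g' f f' gg ff v; rewrite /= ff gg.
Defined.

Definition Rep : zcategory.
refine (@ZCategory Rep_cat rep_zero _ _) => //.
by move=> V W Z f v; rewrite /= linear0.
Defined.

End SmoothReps.

Definition Mod_cat (R : pzRingType) : category.
refine (@Category (lmodType R) (fun M N => {linear M -> N})
  (fun M N f g => f =1 g) (fun M => idfun) (fun M N P g f => g \o f)
  _ _ _ _ _ _ _) => //.
- by move=> M N f g fg v; rewrite fg.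
- by move=> M N f g h fg gh v; rewrite fg gh.
- by move=> M N P g g' f f' gg ff v; rewrite /= ff gg.
Defined.

Definition Mod (R : pzRingType) : zcategory.
refine (@ZCategory (Mod_cat R) (fun M N => \0) _ _) => //.
by move=> M N P f v; rewrite /= linear0.
Defined.

Section Induced.
Variables (k : fieldType) (p : nat) (G : topGroupType).
Variable I : open_pro_p_subgroup p G.

Definition support_of (f : G -> k^o) : set G := [set g | f g != 0].

Definition indI : {pred (G -> k^o)} := fun f =>
  `[< compact (closure (support_of f)) /\
      (forall g i, ops_set I i -> f (g * i)%g = f g) >].

Let I1 : ops_set I 1%g. Proof. by case: (ops_pro_p I) => -[]. Qed.
Let IM x y : ops_set I x -> ops_set I y -> ops_set I (x * y)%g.
Proof. by case: (ops_pro_p I) => -[] _ + _ _ _ _ _; apply. Qed.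
Let IV x : ops_set I x -> ops_set I (x^-1)%g.
Proof. by case: (ops_pro_p I) => -[] _ _ + _ _ _ _; apply. Qed.
Let IC : compact I. Proof. by case: (ops_pro_p I). Qed.

Lemma left_coset_open (g : G) : open (left_coset g I).
Proof.
apply: (@open_comp _ _ (fun x => (g^-1 * x)%g) I).
  by move=> x _; exact: mulgl_continuous.
exact: ops_open.
Qed.

Lemma left_coset_id (g : G) : left_coset g I g.
Proof. by rewrite /left_coset /= mulVg. Qed.

Lemma right_inv_open (f : G -> k^o) :
  (forall g i, ops_set I i -> f (g * i)%g = f g) ->
  forall P : set k, open [set g | P (f g)].
Proof.
move=> fI P; rewrite openE => g Pg.
have := open_nbhs_nbhs (conj (left_coset_open g) (left_coset_id g)).
by apply: filterS => x /= Ix; rewrite -[x](mulVKg g) fI.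
Qed.

Lemma support_closed (f : G -> k^o) :
  (forall g i, ops_set I i -> f (g * i)%g = f g) -> closure (support_of f) = support_of f.
Proof.
move=> fI; apply/esym/closure_id; rewrite -openC.
apply: (@right_inv_open _ fI (fun a => ~ (a != 0))).
Qed.

Lemma indIP (f : G -> k^o) :
  reflect (compact (support_of f) /\ forall g i, ops_set I i -> f (g * i)%g = f g)
          (f \in indI).
Proof.
apply: (iffP (asboolP _)) => -[cf fI]; split=> //; first by
  rewrite -(support_closed fI).
by rewrite (support_closed fI).
Qed.

Lemma indI_closed : GRing.subsemimod_closed indI.
Proof.
have h0 : (0 : G -> k^o) \in indI.
  apply/indIP; split=> //.
  have -> : support_of (0 : G -> k^o) = set0 by
    apply/seteqP; split=> g //=; rewrite /support_of /= eqxx.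
  exact: compact0.
have sub (f g : G -> k^o) (A : set G) :
    (forall g i, ops_set I i -> f (g * i)%g = f g) -> compact A ->
    support_of f `<=` A -> f \in indI.
  move=> fI cA sA; apply/indIP; split=> //.
  apply: subclosed_compact cA sA.
  by rewrite closure_id (support_closed fI).
split; [split=> //|] => [f g /indIP[cf fI] /indIP[cg gI] | a f /indIP[cf fI]].
- apply: (sub _ 0 (support_of f `|` support_of g)).
  + by move=> x i Ii; rewrite /= !fctE fI ?gI.
  + exact: compactU.
  + move=> x /=; rewrite /support_of /= fctE => h.
    have [f0|] := eqVneq (f x) 0; last by left.
    by right; move: h; rewrite f0 add0r.
- apply: (sub _ 0 (support_of f)) => //.
  + by move=> x i Ii; change (a *: f (x * i)%g = a *: f x); rewrite fI.
  + move=> x; change (a *: f x != 0 -> f x != 0).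
    by apply: contra_neq => ->; rewrite scaler0.
Qed.

HB.instance Definition _ := GRing.isSubmodClosed.Build k _ indI indI_closed.

Record indX := IndX { ind_fun : G -> k^o; ind_funP : ind_fun \in indI }.

HB.instance Definition _ := [isSub for ind_fun].
HB.instance Definition _ := [Choice of indX by <:].
HB.instance Definition _ :=
  GRing.SubChoice_isSubLmodule.Build k (G -> k^o) indI indX indI_closed.

Lemma ind_right_inv (f : indX) g i : ops_set I i -> ind_fun f (g * i)%g = ind_fun f g.
Proof. by case/indIP: (ind_funP f) => _; apply. Qed.

Lemma ind_left_coset (f : indX) g h :
  ops_set I (g^-1 * h)%g -> ind_fun f h = ind_fun f g.
Proof. by move=> /(ind_right_inv f g); rewrite mulVKg. Qed.

Lemma translate_indI (g : G) (f : indX) :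
  (fun x => ind_fun f (g^-1 * x)%g) \in indI.
Proof.
apply/indIP; split; last by move=> x i Ii; rewrite mulgA ind_right_inv.
have [cf _] := indIP _ (ind_funP f).
have -> : support_of (fun x => ind_fun f (g^-1 * x)%g) =
    (fun x => g * x)%g @` support_of (ind_fun f).
  apply/seteqP; split=> [x fx|_ [x fx <-]].
    by exists (g^-1 * x)%g => //; rewrite mulVKg.
  by rewrite /support_of /= mulKg.
apply: continuous_compact cf.
by apply: continuous_subspaceT => x; exact: mulgl_continuous.
Qed.

Definition translate (g : G) (f : indX) : indX := IndX (translate_indI g f).

Lemma indX_ext (f h : indX) : (forall x, ind_fun f x = ind_fun h x) -> f = h.
Proof. by move=> /funext E; apply: val_inj. Qed.

Lemma translate_linear (g : G) : linear (translate g).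
Proof. by move=> a f h; apply: indX_ext. Qed.

Lemma translate1 f : translate 1%g f = f.
Proof. by apply: indX_ext => x; rewrite /= invg1 mul1g. Qed.

Lemma translateM g h f : translate (g * h)%g f = translate g (translate h f).
Proof. by apply: indX_ext => x; rewrite /= invgM -mulgA. Qed.

Lemma support_cover (f : indX) : exists s : seq G,
  forall x, ind_fun f x != 0 -> exists2 g, g \in s & ops_set I (g^-1 * x)%g.
Proof.
pose T : ptopologicalType := HB.pack (TopologicalGroup.sort G) (isPointed.Build G 1%g).
have [cf _] := indIP _ (ind_funP f).
have : @cover_compact T (support_of (ind_fun f)).
  by rewrite -compact_cover.
move=> /(_ _ setT (fun g => left_coset g I)) [].
- by move=> g _; exact: left_coset_open.
- by move=> x _; exists x => //; exact: left_coset_id.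
- move=> D _ fD; exists (finmap.enum_fset D) => x /fD[g gD Ig].
  by exists g.
Qed.

Lemma translate_smooth f : open [set g | translate g f = f].
Proof.
have sub : is_subgroup [set g | translate g f = f].
  split=> [|x y|x] /=; rewrite ?translate1 // ?translateM.
    by move=> xf ->.
  by move=> xf; rewrite -{1}xf -translateM mulVg translate1.
apply: open_subgroup sub _.
have [s sP] := support_cover f.
have nI g : nbhs 1%g [set x | ops_set I (g^-1 * (x * g))%g].
  have h : nbhs (g^-1 * (1 * g))%g (I : set G).
    by rewrite mul1g mulVg; apply: open_nbhs_nbhs; split; [exact: ops_open|].
  have h1 := @mulgl_continuous G g^-1%g _ _ h.
  have [[P Q] /= [P1 Qg] PQ] := @mulg_continuous G (1%g, g) _ h1.
  by apply: filterS P1 => x Px; apply: (PQ (x, g)); split => //=; exact: nbhs_singleton.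
have : nbhs 1%g [set x | forall g, g \in s -> ops_set I (g^-1 * (x^-1 * g))%g].
  have {}nI g : nbhs 1%g [set x | ops_set I (g^-1 * (x^-1 * g))%g].
    have /= := @invg_continuous G 1%g [set x | ops_set I (g^-1 * (x * g))%g].
    by rewrite invg1; apply; exact: nI.
  elim: s {sP} => [|g s IH]; first by apply: filterS filterT.
  apply: filterS (filterI (nI g) IH) => x /= [xg xs] h.
  by rewrite inE => /predU1P[->|/xs].
apply: filterS => x xs /=.
have half (y : G) : ind_fun f y != 0 -> ind_fun f (x^-1 * y)%g = ind_fun f y.
  move=> /sP[g /xs Ixg Iy]; rewrite (ind_left_coset f Iy).
  apply: ind_left_coset.
  have -> : (g^-1 * (x^-1 * y) = g^-1 * (x^-1 * g) * (g^-1 * y))%g.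
    by rewrite -!mulgA mulVKg.
  exact: IM.
have {}half' (y : G) : ind_fun f y != 0 -> ind_fun f (x * y)%g = ind_fun f y.
  move=> /sP[g /xs Ixg Iy]; rewrite (ind_left_coset f Iy).
  apply: ind_left_coset.
  have -> : (g^-1 * (x * y) = (g^-1 * (x^-1 * g))^-1 * (g^-1 * y))%g.
    by rewrite !invgM !invgK -!mulgA mulVKg.
  by apply: IM => //; exact: IV.
apply: indX_ext => y /=.
have [fy0|/half //] := eqVneq (ind_fun f y) 0.
have [->//|h] := eqVneq (ind_fun f (x^-1 * y)%g) 0.
by rewrite -(half' _ h) mulVKg.
Qed.

Definition X : smooth_rep k G :=
  SmoothRep translate_linear translate1 translateM translate_smooth.

Lemma one_I_indI : (fun g => (`[< ops_set I g >])%:R : k^o) \in indI.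
Proof.
apply/indIP; split.
  suff -> : support_of (fun g => (`[< ops_set I g >])%:R : k^o) = ops_set I by [].
  apply/seteqP; split=> g; rewrite /support_of /=; case: asboolP => //= _ /=.
    by rewrite eqxx.
  by rewrite oner_eq0.
move=> g i Ii; congr (_%:R); congr nat_of_bool; apply: asbool_equiv_eq.
split=> [h|h]; last exact: IM.
by rewrite -[g](mulgK i); apply: IM => //; exact: IV.
Qed.

Definition one_I : X := IndX one_I_indI.

Definition coset_repr (g : G) : G := xget 1%g (left_coset g I).

Definition coset_reprs : set G := [set g | coset_repr g = g].

Lemma coset_reprP g : ops_set I (g^-1 * coset_repr g)%g.
Proof. by apply: (@xgetPex _ 1%g (left_coset g I)); exists g; exact: left_coset_id. Qed.

Lemma coset_repr_eq g h : ops_set I (g^-1 * h)%g -> coset_repr g = coset_repr h.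
Proof.
move=> gh; congr xget; apply/seteqP; split=> x; rewrite /left_coset /= => Ix.
  have -> : (h^-1 * x = (g^-1 * h)^-1 * (g^-1 * x))%g.
    by rewrite invgM invgK -!mulgA mulVKg.
  by apply: IM => //; exact: IV.
have -> : (g^-1 * x = (g^-1 * h) * (h^-1 * x))%g by rewrite -!mulgA mulVKg.
exact: IM.
Qed.

Lemma coset_reprK g : coset_repr (coset_repr g) = coset_repr g.
Proof. by apply/esym/coset_repr_eq/coset_reprP. Qed.

Section Frobenius.
Variable V : smooth_rep k G.

Definition I_invariant (v : V) : Prop := forall i, ops_set I i -> act i v = v.

(* for [I]-invariant [v], the unique [G]-equivariant map [X -> V] sending the
   indicator function of [I] to [v]; the sum runs over [G/I] *)
Definition frob (v : V) (f : X) : V :=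
  \sum_(g \in coset_reprs) ind_fun f g *: act g v.

Lemma support_reprs (f : indX) : exists s : seq G,
  [/\ uniq s, forall g, g \in s -> coset_repr g = g &
      forall g, coset_repr g = g -> ind_fun f g != 0 -> g \in s].
Proof.
have [s sP] := support_cover f.
exists (undup [seq coset_repr g | g <- s]); split; first exact: undup_uniq.
  by move=> g; rewrite mem_undup => /mapP[h _ ->]; exact: coset_reprK.
move=> g rg /sP[h hs Ih]; rewrite mem_undup -rg -(coset_repr_eq Ih).
exact: map_f.
Qed.

Lemma frob_seq (v : V) (f : X) (s : seq G) :
  uniq s -> (forall g, g \in s -> coset_repr g = g) ->
  (forall g, coset_repr g = g -> ind_fun f g != 0 -> g \in s) ->
  frob v f = \sum_(g <- s) ind_fun f g *: act g v.
Proof.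
move=> us sr sf; rewrite /frob (@fsbigE _ _ _ _ _ s) //; first last.
  move=> g rg; apply: contraNeq => h; apply: sf => //.
  by apply: contra_neq h => ->; rewrite scale0r.
rewrite big_seq_cond [RHS]big_seq_cond; apply: eq_bigl => g.
by case: (boolP (g \in s)) => //= /sr rg; rewrite mem_set.
Qed.

Lemma frob_linear v : linear (frob v).
Proof.
move=> a f h.
have E g : ind_fun (a *: f + h) g = a * ind_fun f g + ind_fun h g by [].
have [s [us sr sf]] := support_reprs f; have [t [ut tr tf]] := support_reprs h.
have st g : g \in undup (s ++ t) -> coset_repr g = g.
  by rewrite mem_undup mem_cat => /orP[/sr|/tr].
rewrite !(@frob_seq v _ (undup (s ++ t))) ?undup_uniq //.
- rewrite scaler_sumr -big_split /=; apply: eq_bigr => g _.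
  transitivity ((a * ind_fun f g + ind_fun h g) *: act g v); first by [].
  by rewrite scalerDl scalerA.
- by move=> g rg hg; rewrite mem_undup mem_cat tf ?orbT.
- by move=> g rg fg; rewrite mem_undup mem_cat sf.
- move=> g rg; rewrite E mem_undup mem_cat => afh; apply/orP.
  have [f0|fg] := eqVneq (ind_fun f g) 0; last by left; exact: sf.
  by right; apply: tf => //; move: afh; rewrite f0 mulr0 add0r.
Qed.

Lemma frob_equiv v : I_invariant v ->
  forall g f, frob v (act g f) = act g (frob v f).
Proof.
move=> Iv g f; have [s [us sr sf]] := support_reprs f.
rewrite (frob_seq v us sr sf).
pose c x := coset_repr (g * x)%g.
have cI x : ops_set I ((g * x)^-1 * c x)%g by exact: coset_reprP.
have inj : {in s &, injective c}.
  move=> x y xs ys cxy; rewrite -(sr x xs) -(sr y ys); apply: coset_repr_eq.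
  have -> : (x^-1 * y = ((g * x)^-1 * c x) * ((g * y)^-1 * c y)^-1)%g.
    by rewrite cxy !invgM !invgK -!mulgA mulVKg mulKg.
  by apply: IM => //; exact: IV.
rewrite (@frob_seq v _ (map c s)).
- rewrite big_map raddf_sum; apply: eq_bigr => x xs /=.
  rewrite linearZ /=; congr (_ *: _).
    apply: ind_left_coset; have := cI x.
    by rewrite invgM mulgA.
  by rewrite -actM -[c x](mulVKg (g * x)%g) [RHS]/(act _ v) actM Iv.
- by rewrite map_inj_in_uniq.
- by move=> x /mapP[y _ ->]; exact: coset_reprK.
- move=> x rx /= fx; apply/mapP; exists (coset_repr (g^-1 * x)%g).
    apply: sf; first exact: coset_reprK.
    by rewrite (ind_left_coset _ (coset_reprP _)).
  rewrite -[LHS]rx /c; apply: coset_repr_eq.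
  by have := coset_reprP (g^-1 * x)%g; rewrite invgM invgK !mulgA.
Qed.

Lemma frob_one_I v : I_invariant v -> frob v one_I = v.
Proof.
move=> Iv; have I0 : ops_set I (coset_repr 1%g).
  by have := coset_reprP 1%g; rewrite invg1 mul1g.
rewrite (@frob_seq v _ [:: coset_repr 1%g]) //.
- by rewrite big_seq1 /= asboolT // scale1r Iv.
- by move=> g; rewrite inE => /eqP ->; exact: coset_reprK.
- move=> g rg /=; case: asboolP => [Ig _|]; last by rewrite eqxx.
  by rewrite inE -{1}rg; apply/eqP/esym/coset_repr_eq; rewrite invg1 mul1g.
Qed.

Definition frob_hom v (Iv : I_invariant v) : rep_hom X V :=
  RepHom (frob_linear v) (frob_equiv Iv).

End Frobenius.

Lemma one_I_invariant : I_invariant one_I.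
Proof.
move=> i Ii; apply: indX_ext => x /=; congr (_%:R); congr nat_of_bool.
apply: asbool_equiv_eq; split=> [h|h].
  by rewrite -[x](mulVKg i); exact: IM.
by apply: IM => //; exact: IV.
Qed.

Lemma hom_one_I_invariant (V : smooth_rep k G) (f : rep_hom X V) :
  I_invariant (f one_I).
Proof. by move=> i Ii; rewrite -rep_equiv one_I_invariant. Qed.

Lemma frob_X (f : X) : frob one_I f = f.
Proof.
have [s [us sr sf]] := support_reprs f.
rewrite (frob_seq _ us sr sf); apply: indX_ext => x.
have -> : ind_fun (\sum_(g <- s) ind_fun f g *: act g one_I) x =
    \sum_(g <- s) ind_fun f g * ind_fun (act g one_I) x.
  elim: s {us sr sf} => [|g s IH]; first by rewrite !big_nil.
  by rewrite !big_cons -IH.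
have xI : ops_set I ((coset_repr x)^-1 * x)%g.
  by have := IV (coset_reprP x); rewrite invgM invgK.
rewrite -(ind_left_coset f (coset_reprP x)).
have [rs|/negP rs] := boolP (coset_repr x \in s).
  rewrite (bigD1_seq _ rs us) /= asboolT // mulr1 big_seq_cond big1 ?addr0 //.
  move=> g /andP[gs gx]; rewrite asboolF ?mulr0 // => Ig.
  by case/eqP: gx; rewrite -(sr _ gs); exact: coset_repr_eq.
have -> : ind_fun f (coset_repr x) = 0.
  by apply/eqP; apply: contra_notT rs; apply: sf; exact: coset_reprK.
rewrite big_seq big1 // => g gs /=; rewrite asboolF ?mulr0 // => Ig.
by apply: rs; rewrite -(coset_repr_eq Ig) sr.
Qed.

Lemma frob_unique (V : smooth_rep k G) (f f' : rep_hom X V) :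
  f one_I = f' one_I -> f =1 f'.
Proof.
move=> e x; rewrite -(frob_X x); have [s [us sr sf]] := support_reprs x.
rewrite (frob_seq _ us sr sf) !raddf_sum; apply: eq_bigr => g _.
by rewrite /= !linearZ /= !rep_equiv e.
Qed.

Definition endX : Type := rep_hom X X.

HB.instance Definition _ := gen_eqMixin endX.
HB.instance Definition _ := gen_choiceMixin endX.

Definition endX_add (f g : endX) : endX := rep_add f g.
Definition endX_opp (f : endX) : endX := rep_opp f.

Lemma endX_addA : associative endX_add.
Proof. by move=> f g h; apply: rep_hom_ext => x /=; rewrite addrA. Qed.
Lemma endX_addC : commutative endX_add.
Proof. by move=> f g; apply: rep_hom_ext => x /=; rewrite addrC. Qed.
Lemma endX_add0 : left_id (rep_zero X X : endX) endX_add.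
Proof. by move=> f; apply: rep_hom_ext => x /=; rewrite add0r. Qed.
Lemma endX_addN : left_inverse (rep_zero X X : endX) endX_opp endX_add.
Proof. by move=> f; apply: rep_hom_ext => x /=; rewrite addNr. Qed.

HB.instance Definition _ :=
  GRing.isZmodule.Build endX endX_addA endX_addC endX_add0 endX_addN.

Definition endX_mul (f g : endX) : endX := rep_comp f g.

Lemma endX_mulA : associative endX_mul.
Proof. by move=> f g h; apply: rep_hom_ext. Qed.
Lemma endX_mul1 : left_id (rep_id X : endX) endX_mul.
Proof. by move=> f; apply: rep_hom_ext. Qed.
Lemma endX_1mul : right_id (rep_id X : endX) endX_mul.
Proof. by move=> f; apply: rep_hom_ext. Qed.
Lemma endX_mulDl : left_distributive endX_mul +%R.
Proof. by move=> f g h; apply: rep_hom_ext. Qed.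
Lemma endX_mulDr : right_distributive endX_mul +%R.
Proof. by move=> f g h; apply: rep_hom_ext => x /=; rewrite raddfD. Qed.

HB.instance Definition _ := GRing.Zmodule_isPzRing.Build endX
  endX_mulA endX_mul1 endX_1mul endX_mulDl endX_mulDr.

(* [H = End_G(X)^op] *)
Definition Hecke : pzRingType := (endX^c : pzRingType).

Definition X_act (x : X) (h : Hecke) : X := (h : endX) x.

Lemma X_act1 x : X_act x 1 = x. Proof. by []. Qed.
Lemma X_actM x h1 h2 : X_act x (h1 * h2) = X_act (X_act x h1) h2.
Proof. by []. Qed.
End Induced.

Arguments indX {k p G} I.
Arguments X k {p G} I.
Arguments Hecke k {p G} I.
Arguments endX k {p G} I.
Arguments one_I {k p G I}.
Arguments X_act {k p G I} x h.

Section Invariants.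
Variables (k : fieldType) (p : nat) (G : topGroupType).
Variable I : open_pro_p_subgroup p G.
Notation H := (Hecke k I).

Section InvModule.
Variable V : smooth_rep k G.

Definition inv_pred : {pred V} := fun v => `[< I_invariant I v >].

Lemma inv_zmod_closed : GRing.zmod_closed inv_pred.
Proof.
split; first by apply/asboolP => i _; rewrite linear0.
move=> u v /asboolP Iu /asboolP Iv; apply/asboolP => i Ii.
by rewrite linearB /= Iu // Iv.
Qed.

Record invariants := Invariants { inv_val : V; inv_valP : inv_val \in inv_pred }.

HB.instance Definition _ := [isSub for inv_val].
HB.instance Definition _ := [Choice of invariants by <:].
HB.instance Definition _ :=
  GRing.SubChoice_isSubZmodule.Build V inv_pred invariants inv_zmod_closed.

Lemma inv_invariant (v : invariants) : I_invariant I (inv_val v).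
Proof. exact/asboolP/inv_valP. Qed.

Definition inv_of (v : V) (Iv : I_invariant I v) : invariants :=
  Invariants (introT (asboolP _) Iv).

(* the isomorphism [V^I ~ Hom_G(X, V)] *)
Definition inv_to_hom (v : invariants) : rep_hom (X k I) V :=
  frob_hom (inv_invariant v).

Definition hom_to_inv (f : rep_hom (X k I) V) : invariants :=
  inv_of (hom_one_I_invariant f).

Lemma inv_to_homK : cancel inv_to_hom hom_to_inv.
Proof. by move=> v; apply: val_inj; exact: frob_one_I (inv_invariant v). Qed.

Lemma inv_to_hom_one (v : invariants) : inv_to_hom v one_I = inv_val v.
Proof. exact: frob_one_I (inv_invariant v). Qed.

Lemma hom_to_invK : cancel hom_to_inv inv_to_hom.
Proof.
by move=> f; apply/rep_hom_ext/frob_unique; rewrite inv_to_hom_one.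
Qed.

(* [H] acts on [Hom_G(X, V)] by precomposition *)
Definition inv_scale (h : H) (v : invariants) : invariants :=
  hom_to_inv (rep_comp (inv_to_hom v) (h : endX k I)).

Lemma inv_scaleA a b v : inv_scale a (inv_scale b v) = inv_scale (a * b) v.
Proof. by rewrite /inv_scale hom_to_invK; congr hom_to_inv; apply: rep_hom_ext. Qed.

Lemma inv_scale1 : left_id 1 inv_scale.
Proof. by move=> v; rewrite -[RHS]inv_to_homK; congr hom_to_inv; apply: rep_hom_ext. Qed.

Lemma inv_to_homD u v : inv_to_hom (u + v) = rep_add (inv_to_hom u) (inv_to_hom v).
Proof.
apply/rep_hom_ext/frob_unique; rewrite inv_to_hom_one /=.
by rewrite !frob_one_I //; exact: inv_invariant.
Qed.

Lemma inv_scaleDr : right_distributive inv_scale +%R.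
Proof. by move=> a u v; rewrite /inv_scale inv_to_homD; apply: val_inj. Qed.

Lemma inv_scaleDl v : {morph inv_scale^~ v : a b / a + b}.
Proof.
move=> a b; apply: val_inj.
exact: (linearD (inv_to_hom v) ((a : endX k I) one_I) ((b : endX k I) one_I)).
Qed.

HB.instance Definition _ := GRing.Zmodule_isLmodule.Build H invariants
  inv_scaleA inv_scale1 inv_scaleDr inv_scaleDl.

End InvModule.

Section InvMap.
Variables (V W : smooth_rep k G) (f : rep_hom V W).

Lemma inv_map_subproof (v : invariants V) : I_invariant I (f (inv_val v)).
Proof. by move=> i Ii; rewrite -rep_equiv (inv_invariant v). Qed.

Definition inv_map (v : invariants V) : invariants W := inv_of (inv_map_subproof v).

Lemma inv_to_hom_map v : inv_to_hom (inv_map v) =1 f \o inv_to_hom v.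
Proof.
apply: (@frob_unique _ _ _ _ _ (inv_to_hom (inv_map v)) (rep_comp f (inv_to_hom v))).
rewrite inv_to_hom_one /=; congr (rep_fun f _).
exact/esym/(inv_to_hom_one v).
Qed.

Lemma inv_map_linear : linear inv_map.
Proof.
move=> a u v; apply: val_inj; rewrite /= linearD; congr (_ + _).
by rewrite -[RHS]/(inv_to_hom (inv_map u) _) inv_to_hom_map.
Qed.

HB.instance Definition _ := GRing.isLinear.Build H (invariants V) (invariants W) _
  inv_map inv_map_linear.

End InvMap.

Definition inv_functor0 : functor (Rep k G) (Mod H).
refine (@Functor (Rep k G) (Mod H) invariants (fun V W f => inv_map f) _ _ _).
- by move=> V W f g fg v; apply: val_inj; rewrite /= fg.
- by move=> V v; apply: val_inj.
- by move=> V W Z g f v; apply: val_inj.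
Defined.

Definition inv_functor : zfunctor (Rep k G) (Mod H).
refine (@ZFunctor _ _ inv_functor0 _).
by move=> V W v; apply: val_inj.
Defined.

End Invariants.

Section Tensor.
Variables (k : fieldType) (p : nat) (G : topGroupType).
Variable I : open_pro_p_subgroup p G.
Notation H := (Hecke k I).

Section TensorModule.
Variable M : lmodType H.

(* A formal sum of pure tensors is a list of pairs. The [k]-balancing relations
   are instances of [tens_bal], as [H] contains the scalars. *)
Inductive tens_rel : seq (X k I * M) -> seq (X k I * M) -> Prop :=
| tens_refl s : tens_rel s s
| tens_sym s t : tens_rel s t -> tens_rel t s
| tens_trans s t u : tens_rel s t -> tens_rel t u -> tens_rel s u
| tens_cat s s' t t' :
    tens_rel s s' -> tens_rel t t' -> tens_rel (s ++ t) (s' ++ t')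
| tens_comm s t : tens_rel (s ++ t) (t ++ s)
| tens_zero m : tens_rel [:: (0, m)] [::]
| tens_addl x x' m : tens_rel [:: (x + x', m)] [:: (x, m); (x', m)]
| tens_addr x m m' : tens_rel [:: (x, m + m')] [:: (x, m); (x, m')]
| tens_bal x h m : tens_rel [:: (X_act x h, m)] [:: (x, h *: m)].

Definition tens_relb (s t : seq (X k I * M)) : bool := `[< tens_rel s t >].

Lemma tens_relb_equiv : equiv_class_of tens_relb.
Proof.
split=> [s|s t|t s u].
- by apply/asboolP; exact: tens_refl.
- by apply: asbool_equiv_eq; split; exact: tens_sym.
- by move=> /asboolP st /asboolP tu; apply/asboolP; exact: tens_trans st tu.
Qed.

Canonical tens_equiv := EquivRelPack tens_relb_equiv.

Definition tensor : Type := {eq_quot tens_equiv}%qT.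

HB.instance Definition _ := Choice.on tensor.
HB.instance Definition _ := EqQuotient.on tensor.

Definition tens (s : seq (X k I * M)) : tensor := (\pi_({eq_quot tens_equiv}%qT) s)%qT.

Lemma tens_eq s t : tens_rel s t -> tens s = tens t.
Proof. by move=> st; apply/eqquotP/asboolP. Qed.

Lemma tens_eqP s t : tens s = tens t -> tens_rel s t.
Proof. by move=> /eqquotP/asboolP. Qed.

Lemma tens_repr (a : tensor) : exists s, a = tens s.
Proof. by exists (repr (a : {eq_quot tens_equiv}%qT)); rewrite /tens reprK. Qed.

End TensorModule.

Section TensorMap.
Variables (M N : lmodType H).

(* [tens_map phi psi] is induced by [phi \otimes psi] *)
Definition tens_map (phi : X k I -> X k I) (psi : M -> N) (a : tensor M) : tensor N :=
  tens [seq (phi u.1, psi u.2) | u <- repr (a : {eq_quot tens_equiv M}%qT)].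

Lemma tens_mapE (phi : {additive X k I -> X k I}) (psi : {linear M -> N}) s :
  (forall x h, phi (X_act x h) = X_act (phi x) h) ->
  tens_map phi psi (tens s) = tens [seq (phi u.1, psi u.2) | u <- s].
Proof.
move=> phiH; apply: tens_eq.
have : tens_rel (repr (tens s : {eq_quot tens_equiv M}%qT)) s.
  by apply: tens_eqP; rewrite {1}/tens reprK.
move: (repr _) => r; elim=> {r s} /=.
- by move=> s; exact: tens_refl.
- by move=> s t _; exact: tens_sym.
- by move=> s t u _ + _; exact: tens_trans.
- by move=> s s' t t' _ + _ + /[!map_cat]; exact: tens_cat.
- by move=> s t; rewrite !map_cat; exact: tens_comm.
- by move=> m; rewrite raddf0; exact: tens_zero.
- by move=> x x' m; rewrite raddfD; exact: tens_addl.
- by move=> x m m'; rewrite linearD; exact: tens_addr.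
- by move=> x h m; rewrite linearZ phiH; exact: tens_bal.
Qed.

End TensorMap.

Section TensorModuleStructure.
Variable M : lmodType H.

Definition tens_add (a b : tensor M) : tensor M :=
  tens (repr (a : {eq_quot tens_equiv M}%qT) ++ repr (b : {eq_quot tens_equiv M}%qT)).

Lemma tens_addE s t : tens_add (tens s) (tens t) = tens (s ++ t).
Proof.
by apply: tens_eq; apply: tens_cat; apply: tens_eqP; rewrite {1}/tens reprK.
Qed.

Definition tens_opp : tensor M -> tensor M := tens_map (fun x => - x) idfun.

Lemma tens_oppE s : tens_opp (tens s) = tens [seq (- u.1, u.2) | u <- s].
Proof.
rewrite /tens_opp (@tens_mapE M M -%R idfun) // => x h.
exact/esym/(linearN (rep_fun (h : endX k I)) x).
Qed.

Definition tens_scale (c : k) : tensor M -> tensor M :=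
  tens_map (fun x => c *: x) idfun.

Lemma tens_scaleE c s : tens_scale c (tens s) = tens [seq (c *: u.1, u.2) | u <- s].
Proof.
rewrite /tens_scale (@tens_mapE M M ( *:%R c) idfun) // => x h.
exact/esym/(linearZ_LR (rep_fun (h : endX k I)) c x).
Qed.

Definition tens_act (g : G) : tensor M -> tensor M := tens_map (act g) idfun.

Lemma tens_actE g s : tens_act g (tens s) = tens [seq (act g u.1, u.2) | u <- s].
Proof.
rewrite /tens_act (@tens_mapE M M (act g) idfun) // => x h.
exact/esym/(rep_equiv (h : endX k I)).
Qed.

Lemma tens_addA : associative tens_add.
Proof.
move=> a b c; have [[[s ->] [t ->]] [u ->]] := (tens_repr a, tens_repr b, tens_repr c).
by rewrite !tens_addE catA.
Qed.

Lemma tens_addC : commutative tens_add.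
Proof.
move=> a b; have [[s ->] [t ->]] := (tens_repr a, tens_repr b).
by rewrite !tens_addE; apply: tens_eq; exact: tens_comm.
Qed.

Lemma tens_add0 : left_id (tens [::]) tens_add.
Proof. by move=> a; have [s ->] := tens_repr a; rewrite tens_addE. Qed.

Lemma tens_addN : left_inverse (tens [::]) tens_opp tens_add.
Proof.
move=> a; have [s ->] := tens_repr a; rewrite tens_oppE tens_addE.
apply: tens_eq; elim: s => [|[x m] s IH]; first exact: tens_refl.
set s' := map _ s in IH *.
have h : tens_rel (s' ++ ([:: (x, m)] ++ s)) [:: (x, m)].
  apply: tens_trans (tens_comm _ _) _; rewrite -catA -[X in tens_rel _ X]cats0.
  apply: tens_cat; first exact: tens_refl.
  exact: tens_trans (tens_comm _ _) IH.
apply: (@tens_trans M _ ([:: (- x, m)] ++ [:: (x, m)])).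
  exact: (tens_cat (tens_refl [:: (- x, m)]) h).
apply: tens_trans (tens_sym (tens_addl _ _ _)) _.
by rewrite addNr; exact: tens_zero.
Qed.

HB.instance Definition _ :=
  GRing.isZmodule.Build (tensor M) tens_addA tens_addC tens_add0 tens_addN.

Lemma tensD s t : tens s + tens t = tens (s ++ t) :> tensor M.
Proof. exact: tens_addE. Qed.

Lemma tens_cons x m s : tens ((x, m) :: s) = tens [:: (x, m)] + tens s :> tensor M.
Proof. by rewrite tensD. Qed.

Lemma tens_scaleA a b v : tens_scale a (tens_scale b v) = tens_scale (a * b) v.
Proof.
have [s ->] := tens_repr v; rewrite !tens_scaleE -map_comp; congr tens.
by apply: eq_map => u /=; rewrite scalerA.
Qed.

Lemma tens_scale1 : left_id 1 tens_scale.
Proof.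
move=> v; have [s ->] := tens_repr v; rewrite tens_scaleE; congr tens.
by rewrite -[RHS]map_id; apply: eq_map => -[x m] /=; rewrite scale1r.
Qed.

Lemma tens_scaleDr : right_distributive tens_scale +%R.
Proof.
move=> a u v; have [[s ->] [t ->]] := (tens_repr u, tens_repr v).
by rewrite tensD !tens_scaleE tensD map_cat.
Qed.

Lemma tens_scaleDl v : {morph tens_scale^~ v : a b / a + b}.
Proof.
move=> a b; have [s ->] := tens_repr v; rewrite !tens_scaleE.
elim: s => [|[x m] s IH] /=; first by rewrite tensD.
rewrite !(tens_cons _ _ (map _ _)) IH addrACA; congr (_ + _).
by rewrite scalerDl tensD; apply: tens_eq; exact: tens_addl.
Qed.

HB.instance Definition _ := GRing.Zmodule_isLmodule.Build k (tensor M)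
  tens_scaleA tens_scale1 tens_scaleDr tens_scaleDl.

Lemma tensZ c s : c *: tens s = tens [seq (c *: u.1, u.2) | u <- s] :> tensor M.
Proof. exact: tens_scaleE. Qed.

Lemma tens_act_linear g : linear (tens_act g).
Proof.
move=> a u v; have [[s ->] [t ->]] := (tens_repr u, tens_repr v).
rewrite tensZ tensD !tens_actE tensZ tensD map_cat -!map_comp; congr (tens (_ ++ _)).
by apply: eq_map => w /=; congr pair; exact: (linearZ_LR (act g) a w.1).
Qed.

Lemma tens_act1 v : tens_act 1%g v = v.
Proof.
have [s ->] := tens_repr v; rewrite tens_actE; congr tens.
by rewrite -[RHS]map_id; apply: eq_map => -[x m] /=; rewrite translate1.
Qed.

Lemma tens_actM g h v : tens_act (g * h)%g v = tens_act g (tens_act h v).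
Proof.
have [s ->] := tens_repr v; rewrite !tens_actE -map_comp; congr tens.
by apply: eq_map => u /=; rewrite translateM.
Qed.

Lemma tens_act_smooth v : open [set g | tens_act g v = v].
Proof.
apply: open_subgroup.
  split=> [|x y|x] /=; rewrite ?tens_act1 // ?tens_actM; first by move=> xf ->.
  by move=> xf; rewrite -{1}xf -tens_actM mulVg tens_act1.
have [s ->] := tens_repr v.
suff : nbhs 1%g [set g | map (fun u => (act g u.1, u.2)) s = s].
  by apply: filterS => g /= e; rewrite tens_actE e.
elim: s => [|[x m] s IH]; first by apply: filterS filterT.
have nx : nbhs 1%g [set g | act g x = x].
  by apply: open_nbhs_nbhs; split; [exact: act_smooth|exact: act1].
by apply: filterS (filterI nx IH) => g /= [-> ->].
Qed.

Definition tensor_rep : smooth_rep k G :=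
  SmoothRep tens_act_linear tens_act1 tens_actM tens_act_smooth.

End TensorModuleStructure.

Section TensorFunctor.
Variables (M N : lmodType H) (f : {linear M -> N}).

Definition tensor_map : tensor_rep M -> tensor_rep N := tens_map idfun f.

Lemma tensor_mapE s : tensor_map (tens s) = tens [seq (u.1, f u.2) | u <- s].
Proof. exact: (@tens_mapE _ _ idfun f). Qed.

Lemma tensor_map_linear : linear tensor_map.
Proof.
move=> a u v; have [[s ->] [t ->]] := (tens_repr u, tens_repr v).
by rewrite tensZ tensD !tensor_mapE tensZ tensD map_cat -!map_comp.
Qed.

Lemma tensor_map_equiv g v : tensor_map (act g v) = act g (tensor_map v).
Proof.
have [s ->] := tens_repr v.
by rewrite /act /= tens_actE !tensor_mapE tens_actE -!map_comp.
Qed.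

Definition tensor_hom : rep_hom (tensor_rep M) (tensor_rep N) :=
  RepHom tensor_map_linear tensor_map_equiv.

End TensorFunctor.

Definition tensor_functor0 : functor (Mod H) (Rep k G).
refine (@Functor (Mod H) (Rep k G) tensor_rep tensor_hom _ _ _).
- move=> M N f g fg v; have [s ->] := tens_repr v.
  by rewrite /= !tensor_mapE; congr tens; apply: eq_map => u; rewrite fg.
- move=> M v; have [s ->] := tens_repr v.
  by rewrite /= tensor_mapE; congr tens; rewrite -[RHS]map_id; apply: eq_map => -[].
- move=> M N P g f v; have [s ->] := tens_repr v.
  by rewrite /= !tensor_mapE -map_comp.
Defined.

Definition tensor_functor : zfunctor (Mod H) (Rep k G).
refine (@ZFunctor _ _ tensor_functor0 _).
move=> M N v; have [s ->] := tens_repr v.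
rewrite /= tensor_mapE; elim: s => [|[x m] s IH] //=.
rewrite tens_cons IH addr0; apply: tens_eq.
rewrite -(scale0r (0 : N)).
apply: tens_trans (tens_sym (tens_bal _ _ _)) _.
exact: tens_zero.
Defined.

End Tensor.

Section TensorInvariants.
Variables (k : fieldType) (p : nat) (G : topGroupType).
Variable I : open_pro_p_subgroup p G.
Notation H := (Hecke k I).

Section Unit.
Variable M : lmodType H.

Lemma unit_invariant (m : M) :
  I_invariant I (tens [:: (one_I, m)] : tensor_rep M).
Proof.
move=> i Ii; rewrite /act /= tens_actE /=; congr (tens [:: (_, _)]).
exact: one_I_invariant.
Qed.

(* [m |-> 1_I \otimes m] *)
Definition tensor_unit (m : M) : invariants I (tensor_rep M) :=
  inv_of (unit_invariant m).

Lemma tensor_unit_hom (m : M) (x : X k I) :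
  inv_to_hom (tensor_unit m) x = tens [:: (x, m)].
Proof.
have lin : linear (fun x : X k I => tens [:: (x, m)] : tensor_rep M).
  move=> a u v; rewrite tensZ tensD; apply: tens_eq; exact: tens_addl.
have eqv g (v : X k I) :
    (tens [:: (act g v, m)] : tensor_rep M) = act g (tens [:: (v, m)] : tensor_rep M).
  by rewrite [RHS]/act /= tens_actE.
apply: (@frob_unique _ _ _ _ _ (inv_to_hom (tensor_unit m)) (RepHom lin eqv)).
exact: inv_to_hom_one.
Qed.

Lemma tensor_unit_linear : linear tensor_unit.
Proof.
move=> a u v; apply: val_inj.
transitivity (tens [:: (one_I, a *: u)] + tens [:: (one_I, v)] : tensor M).
  by rewrite tensD; apply: tens_eq; exact: tens_addr.
congr (_ + _); rewrite [RHS]tensor_unit_hom.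
by apply/tens_eq/tens_sym; exact: tens_bal.
Qed.

HB.instance Definition _ := GRing.isLinear.Build H M (invariants I (tensor_rep M)) _
  tensor_unit tensor_unit_linear.

End Unit.

Section Counit.
Variable V : smooth_rep k G.

(* [x \otimes v |-> phi_v(x)], with [phi_v : X -> V] the map attached to [v] *)
Definition counit_seq (s : seq (X k I * invariants I V)) : V :=
  \sum_(u <- s) inv_to_hom u.2 u.1.

Lemma counit_seq_rel s t : tens_rel s t -> counit_seq s = counit_seq t.
Proof.
rewrite /counit_seq; elim=> {s t}.
- by [].
- by move=> s t _ ->.
- by move=> s t u _ -> _ ->.
- by move=> s s' t t' _ e _ e'; rewrite !big_cat /= e e'.
- by move=> s t; rewrite !big_cat /= addrC.
- by move=> m; rewrite big_seq1 big_nil linear0.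
- by move=> x x' m; rewrite !big_cons !big_nil !addr0 linearD.
- by move=> x m m'; rewrite !big_cons !big_nil !addr0 inv_to_homD.
- move=> x h m; rewrite !big_seq1 /=.
  have := hom_to_invK (rep_comp (inv_to_hom m) (h : endX k I)).
  by move/(congr1 (fun f => rep_fun f x)) => /= <-.
Qed.

Definition tensor_counit (a : tensor_rep (invariants I V)) : V :=
  counit_seq (repr (a : {eq_quot tens_equiv (invariants I V)}%qT)).

Lemma tensor_counitE s : tensor_counit (tens s) = counit_seq s.
Proof.
by apply: counit_seq_rel; apply: tens_eqP; rewrite {1}/tens reprK.
Qed.

Lemma tensor_counit_linear : linear tensor_counit.
Proof.
move=> a u v; have [[s ->] [t ->]] := (tens_repr u, tens_repr v).
rewrite tensZ tensD !tensor_counitE /counit_seq big_cat big_map /= scaler_sumr.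
by congr (_ + _); apply: eq_bigr => w _; exact: (linearZ_LR (inv_to_hom w.2) a w.1).
Qed.

Lemma tensor_counit_equiv g v : tensor_counit (act g v) = act g (tensor_counit v).
Proof.
have [s ->] := tens_repr v; rewrite [in LHS]/act /= tens_actE.
rewrite !tensor_counitE /counit_seq big_map [RHS]raddf_sum; apply: eq_bigr => u _.
exact: (rep_equiv (inv_to_hom u.2)).
Qed.

Definition tensor_counit_hom : rep_hom (tensor_rep (invariants I V)) V :=
  RepHom tensor_counit_linear tensor_counit_equiv.

End Counit.

Definition tensor_inv_adjunction :
  adjunction (tensor_functor k I) (inv_functor k I).
refine (@Adjunction _ _ (tensor_functor k I) (inv_functor k I)
  (fun M => tensor_unit (M := M)) tensor_counit_hom _ _ _ _).
- move=> M N f m; apply: val_inj => /=.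
  by rewrite tensor_mapE.
- move=> V W f v; have [s ->] := tens_repr v.
  rewrite /= tensor_mapE !tensor_counitE /counit_seq big_map [RHS]raddf_sum.
  by apply: eq_bigr => u _; exact: inv_to_hom_map.
- move=> M v; have [s ->] := tens_repr v.
  rewrite /= tensor_mapE tensor_counitE /counit_seq big_map /=.
  elim: s => [|[x m] s IH]; first by rewrite big_nil.
  by rewrite big_cons tens_cons -IH; congr (_ + _); exact: tensor_unit_hom.
- move=> V v; apply: val_inj => /=.
  by rewrite tensor_counitE /counit_seq big_seq1 inv_to_hom_one.
Defined.

End TensorInvariants.

Section ProjectiveModel.
Variable R : pzRingType.

Definition dif (M : Ch (Mod R)) (n : int) :
  {linear (M (n + 1) : lmodType R) -> (M n : lmodType R)} := cx_d M n.

Definition chain_fun (M N : Ch (Mod R)) (f : hom M N) (n : int) :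
  {linear (M n : lmodType R) -> (N n : lmodType R)} := chain f n.

(* With the differential written [M (n + 1) -> M n], the homology in degree
   [n + 1] is the quotient of the cycles by [homologous]; every integer is of
   the form [n + 1]. *)
Definition cycle (M : Ch (Mod R)) (n : int) (z : (M (n + 1) : lmodType R)) : Prop :=
  dif M n z = 0.

Definition homologous (M : Ch (Mod R)) (n : int)
    (z z' : (M (n + 1) : lmodType R)) : Prop :=
  exists y : (M (n + 1 + 1) : lmodType R), z - z' = dif M (n + 1) y.

Definition quasi_iso : mor_class (Ch (Mod R)) := fun M N f =>
  forall n : int,
    (forall z z' : (M (n + 1) : lmodType R), cycle z -> cycle z' ->
       homologous (chain_fun f (n + 1) z) (chain_fun f (n + 1) z') ->
       homologous z z') /\
    (forall w : (N (n + 1) : lmodType R), cycle w ->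
       exists2 z : (M (n + 1) : lmodType R), cycle z &
         homologous (chain_fun f (n + 1) z) w).

Definition surjection : mor_class (Ch (Mod R)) := fun M N f =>
  forall (n : int) (y : (N n : lmodType R)), exists x, chain_fun f n x = y.

Definition projective_model : model (Ch (Mod R)) :=
  model_of_fib quasi_iso surjection.

(* definitionally [Ho projective_model] *)
Definition derived_category : category := localization quasi_iso.

End ProjectiveModel.

Section IProjectiveModel.
Variables (k : fieldType) (p : nat) (G : topGroupType).
Variable I : open_pro_p_subgroup p G.

Definition F_Ch : functor (Ch (Mod (Hecke k I))) (Ch (Rep k G)) :=
  Ch_functor (tensor_functor k I).

Definition U_Ch : functor (Ch (Rep k G)) (Ch (Mod (Hecke k I))) :=
  Ch_functor (inv_functor k I).

Definition FU_adjunction : adjunction F_Ch U_Ch :=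
  Ch_adjunction (tensor_inv_adjunction k I).

Definition I_projective_model : model (Ch (Rep k G)) :=
  model_of_fib (fun V W f => quasi_iso (fmap U_Ch f))
               (fun V W f => surjection (fmap U_Ch f)).

End IProjectiveModel.

(* Main.v *)
(** All objects of [Ch(G)] are fibrant and [U] preserves and reflects weak
    equivalences, so the right derived functor of [U] is [U] itself on
    localizations, and everything rests on one computation: for a free [H]-module
    [M] the unit [M -> (X (x)_H M)^I] is bijective, because an [I]-invariant element
    of a finite sum of copies of [X] has components [1_I h] with [h] in [H].
    Cofibrant complexes over [H] are degreewise retracts of free modules, so the unit
    is an isomorphism on them, which yields the Quillen equivalence by two-out-of-three.

    A factorization of [f : V -> W] in [Ch(G)] is obtained from one of [U f] of the form
    [UV -> UV (+) P -> UW], with [P] degreewise free and a twisted differential, by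
    pushing out along the counit [FUV -> V]. As a graded object the pushout is
    [V (+) F P], so [U] maps it isomorphically to [UV (+) P], and the lifting properties
    transfer by adjunction. Over [H], the cofibration part of the factorization
    attaches a cell for every pair of a cycle of the extension itself and a
    bounding chain of its image. *)

From HB Require Import structures.
From Stdlib Require Import Setoid Morphisms.
From mathcomp Require Import all_boot all_order all_algebra.
From mathcomp Require Import boolp classical_sets functions.
From mathcomp Require topology_structure.
Require Import Defs.

Set Implicit Arguments.
Unset Strict Implicit.
Unset Printing Implicit Defensive.

Import GRing.Theory.
Local Open Scope cat_scope.

(** * Rewriting modulo [heq], and isomorphisms *)

#[export] Instance heq_equivalence (C : category) (a b : C) :
  Equivalence (@heq C a b).
Proof.
split; [exact: heq_refl|exact: heq_sym|exact: heq_trans].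
Qed.

#[export] Instance compm_proper (C : category) (a b c : C) :
  Proper (@heq C b c ==> @heq C a b ==> @heq C a c) (@compm C a b c).
Proof. by move=> g g' gg f f' ff; exact: compm_heq. Qed.

#[export] Instance fmap_proper (C D : category) (F : functor C D) (a b : C) :
  Proper (@heq C a b ==> @heq D (F a) (F b)) (@fmap C D F a b).
Proof. by move=> f g; exact: fmap_heq. Qed.

#[export] Hint Resolve heq_refl : core.

Section Isos.
Variable C : category.

Lemma iso_comp (a b c : C) (g : hom b c) (f : hom a b) :
  is_iso g -> is_iso f -> is_iso (g \oc f).
Proof.
move=> [g' [g'g gg']] [f' [f'f ff']]; exists (f' \oc g'); split.
  by rewrite compmA -(compmA f') g'g compm1.
by rewrite compmA -(compmA g) ff' compm1.
Qed.

Lemma iso_mono (a b c : C) (g : hom b c) (f f' : hom a b) :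
  is_iso g -> g \oc f ~= g \oc f' -> f ~= f'.
Proof.
by move=> [h [hg _]] e; rewrite -(comp1m f) -(comp1m f') -hg -!compmA e.
Qed.

Lemma iso_epi (a b c : C) (g g' : hom b c) (f : hom a b) :
  is_iso f -> g \oc f ~= g' \oc f -> g ~= g'.
Proof.
by move=> [h [_ fh]] e; rewrite -(compm1 g) -(compm1 g') -fh !compmA e.
Qed.

(** [is_iso] only asserts existence; an inverse is fixed by choice so that formal inverses in a
    localization can be sent to it. *)
Definition inv_iso (a b : C) (f : hom a b) (fI : is_iso f) : hom b a :=
  projT1 (cid fI).

Lemma inv_isoK (a b : C) (f : hom a b) (fI : is_iso f) :
  inv_iso fI \oc f ~= idm a.
Proof. by rewrite /inv_iso; case: (cid _) => g []. Qed.

Lemma inv_isoVK (a b : C) (f : hom a b) (fI : is_iso f) :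
  f \oc inv_iso fI ~= idm b.
Proof. by rewrite /inv_iso; case: (cid _) => g []. Qed.

Lemma iso_inv (a b : C) (f : hom a b) (fI : is_iso f) : is_iso (inv_iso fI).
Proof. by exists f; rewrite inv_isoK inv_isoVK. Qed.

End Isos.

Lemma fmap_iso (C D : category) (F : functor C D) (a b : C) (f : hom a b) :
  is_iso f -> is_iso (fmap F f).
Proof. by move=> [g [gf fg]]; exists (fmap F g); rewrite -!fmapM gf fg !fmap1. Qed.

Definition idf (C : category) : functor C C :=
  @Functor C C id (fun a b f => f) (fun a b f g e => e) (fun a => heq_refl _)
    (fun a b c g f => heq_refl _).

(** * Universal property of localizations *)

Section LocalizationUniversal.
Variables (C E : category) (W : mor_class C).

Section Lift.
Variable T : functor C E.
Hypothesis TW : forall a b (w : hom a b), W w -> is_iso (fmap T w).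

Fixpoint loc_lift_map a b (f : loc_hom W a b) : hom (T a) (T b) :=
  match f in loc_hom _ a b return hom (T a) (T b) with
  | loc_mor _ _ f => fmap T f
  | loc_inv _ _ w Ww => inv_iso (TW Ww)
  | loc_comp _ _ _ g f => loc_lift_map g \oc loc_lift_map f
  end.

Lemma loc_lift_heq a b (f g : loc_hom W a b) :
  loc_eq f g -> loc_lift_map f ~= loc_lift_map g.
Proof.
elim=> {a b f g} /=.
- by [].
- by move=> a b f g _ ->.
- by move=> a b f g h _ -> _ ->.
- by move=> a b c g g' f f' _ -> _ ->.
- by move=> a b f; rewrite fmap1 compm1.
- by move=> a b f; rewrite fmap1 comp1m.
- by move=> *; rewrite compmA.
- by move=> a b f g ->.
- by move=> *; rewrite fmapM.
- by move=> a b w Ww; rewrite inv_isoK fmap1.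
- by move=> a b w Ww; rewrite inv_isoVK fmap1.
Qed.

Definition loc_lift : functor (localization W) E :=
  @Functor (localization W) E T loc_lift_map loc_lift_heq (fmap1 T)
    (fun a b c g f => heq_refl _).

End Lift.

Variables S T : functor (localization W) E.
Notation loc := (loc_functor W).

(** The morphisms whose naturality square commutes are closed under composition and inverses, and
    the image of [C] generates the localization under these operations. *)
Lemma loc_natural (th : forall x : localization W, hom (S x) (T x)) :
  (forall (a b : C) (f : hom a b),
    th (loc b) \oc fmap S (fmap loc f) ~= fmap T (fmap loc f) \oc th (loc a)) ->
  forall (a b : localization W) (f : hom a b),
    th b \oc fmap S f ~= fmap T f \oc th a.
Proof.
move=> nat a b; elim=> {a b}.
- exact: nat.
- move=> a b w Ww.
  pose v : @hom (localization W) b a := loc_inv Ww.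
  have vw : v \oc fmap loc w ~= idm _ by exact: loc_invl.
  have wv : fmap loc w \oc v ~= idm _ by exact: loc_invr.
  (* Insert [T v] after [T w] on the left, move [T w] past [th] by naturality at [w], then cancel
     [S w] against [S v]. *)
  rewrite -/v -[X in X ~= _]comp1m -(fmap1 T) -vw fmapM -compmA.
  by rewrite (compmA _ (th (loc a))) -nat -(compmA (th (loc b))) -fmapM wv fmap1 compm1.
- move=> a b c g IHg f IHf.
  have SM := fmapM S (g : hom (b : localization W) c) (f : hom (a : localization W) b).
  have TM := fmapM T (g : hom (b : localization W) c) (f : hom (a : localization W) b).
  by rewrite SM TM compmA IHg -compmA IHf compmA.
Qed.

End LocalizationUniversal.

Lemma loc_iso (C : category) (W : mor_class C) (a b : C) (w : hom a b) :
  W _ _ w -> is_iso (fmap (loc_functor W) w).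
Proof.
by move=> Ww; exists (loc_inv Ww); split; [exact: loc_invl|exact: loc_invr].
Qed.

(** * Lifting properties and model structures *)

Section Lifting.
Variable C : category.
Implicit Types a b c x y z : C.

Lemma lifting_heq a b x y (i i' : hom a b) (q q' : hom x y) :
  i ~= i' -> q ~= q' -> has_lifting i q -> has_lifting i' q'.
Proof.
move=> ii qq L u v e.
have /L[h [hi qh]] : q \oc u ~= v \oc i by rewrite ii qq.
by exists h; rewrite -ii -qq.
Qed.

Lemma lifting_id a x y (q : hom x y) : has_lifting (idm a) q.
Proof. by move=> u v e; exists u; rewrite compm1 e compm1. Qed.

Lemma lifting_comp a b c x y (j : hom b c) (i : hom a b) (q : hom x y) :
  has_lifting j q -> has_lifting i q -> has_lifting (j \oc i) q.
Proof.
move=> Lj Li u v; rewrite compmA => /Li[h [hi qh]].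
have [l [lj ql]] := Lj _ _ qh; exists l; split => //.
by rewrite compmA lj.
Qed.

Lemma lifting_retract a b a' b' x y (i : hom a b) (j : hom a' b') (q : hom x y) :
  is_retract i j -> has_lifting j q -> has_lifting i q.
Proof.
move=> [s [r [s' [r' [rs rs' js ir]]]]] L u v e.
have [h [hj qh]] : exists h, h \oc j ~= u \oc r /\ q \oc h ~= v \oc r'.
  by apply: L; rewrite compmA e -compmA ir compmA.
exists (h \oc s'); split.
  by rewrite -compmA -js compmA hj -compmA rs compm1.
by rewrite compmA qh -compmA rs' compm1.
Qed.

(** The retract argument: a lift in the square with [j] above and the identity below is a section of
    [q] compatible with [i] and [j]. *)
Lemma lifting_retract_factor a b z (i : hom a b) (j : hom a z) (q : hom z b) :
  q \oc j ~= i -> has_lifting i q -> is_retract i j.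
Proof.
move=> qj L; have [|h [hi qh]] := L j (idm b); first by rewrite comp1m.
exists (idm a), (idm a), h, q; split; rewrite ?compm1 //; exact: heq_sym.
Qed.

Section ModelOfFib.
Variables W Fb : mor_class C.
Let M := model_of_fib W Fb.
Let LLP a b (i : hom a b) := forall x y (q : hom x y), Fb q -> has_lifting i q.
Hypothesis Wsub : is_subcategory W.
Hypothesis Fsub : is_subcategory Fb.
Hypothesis W23 : two_of_three W.
Hypothesis Wret : retract_closed W.
Hypothesis Fret : retract_closed Fb.
Hypothesis fact_cof : forall a b (f : hom a b), exists z (i : hom a z) (q : hom z b),
  [/\ cof M i, triv_fib M q & q \oc i ~= f].
Hypothesis fact_triv_cof : forall a b (f : hom a b), exists z (i : hom a z) (q : hom z b),
  [/\ LLP i, W i, Fb q & q \oc i ~= f].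

(** Factor [i] as [q] after [j], with [j] lifting against all fibrations. By two-out-of-three [q] is
    a trivial fibration, so [i] lifts against it and is a retract of [j]. *)
Lemma llp_of_triv_cof a b (i : hom a b) : cof M i -> W i -> LLP i.
Proof.
move=> Ci Wi x y q' Fq'; have [z [j [q [Lj Wj Fq qj]]]] := fact_triv_cof i.
have Wqj : W (q \oc j) by case: Wsub => h _ _; apply: h Wi; rewrite qj.
have Wq : W q by case: (W23 q j) => _ h _; exact: h.
exact: lifting_retract (lifting_retract_factor qj (Ci _ _ _ Fq Wq)) (Lj _ _ _ Fq').
Qed.

Lemma model_of_fib_structure : is_model_structure M.
Proof.
split=> //.
- split=> [a b f g fg Lf|a|a b c g f Lg Lf] x y q Fq Wq.
  + exact: lifting_heq (Lf _ _ _ Fq Wq).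
  + exact: lifting_id.
  + by apply: lifting_comp; [exact: Lg|exact: Lf].
- move=> a b x y f g fg Lg x' y' q Fq Wq.
  exact: lifting_retract fg (Lg _ _ _ Fq Wq).
- by move=> a b x y i q Ci [Fq Wq]; exact: Ci.
- by move=> a b x y i q [Ci Wi]; exact: llp_of_triv_cof.
- move=> a b f; have [z [i [q [Li Wi Fq qi]]]] := fact_triv_cof f.
  exists z, i, q; split=> //; split=> // x y q' Fq' _; exact: Li.
Qed.

End ModelOfFib.

(** Such an [i] lifts against the fibration in its own factorization, hence is a retract of a
    trivial cofibration. *)
Lemma weq_of_lifting (M : model C) a b (i : hom a b) : is_model_structure M ->
  (forall x y (q : hom x y), fib M q -> has_lifting i q) -> weq M i.
Proof.
move=> MS L; have [z [j [q [[_ Wj] Fq qj]]]] := ms_factor_triv_cof MS i.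
apply: (ms_weq_retract MS) Wj; exact: lifting_retract_factor qj (L _ _ _ Fq).
Qed.

End Lifting.

Section AdjunctionLifting.
Variables (C D : category) (F : functor C D) (U : functor D C).
Variable adj : adjunction F U.

(** Transpose the square along the adjunction, lift there, and transpose the lift back. *)
Lemma adj_lifting (a b : C) (x y : D) (i : hom a b) (q : hom x y) :
  has_lifting i (fmap U q) -> has_lifting (fmap F i) q.
Proof.
move=> L u v e.
have [|h [hi qh]] := L (fmap U u \oc unit_ adj a) (fmap U v \oc unit_ adj b).
  by rewrite compmA -fmapM e fmapM -compmA -unit_nat compmA.
exists (counit_ adj x \oc fmap F h); split.
  rewrite -compmA -fmapM hi fmapM compmA counit_nat -compmA triangle_left.
  by rewrite compm1.
by rewrite compmA -counit_nat -compmA -fmapM qh fmapM compmA counit_nat -compmA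
  triangle_left compm1.
Qed.

End AdjunctionLifting.

(** * Derived adjunctions when all objects of the target are fibrant *)

Section DerivedEquivalence.
Variables (C D : category) (MC : model C) (MD : model D).
Variables (F : functor C D) (U : functor D C) (adj : adjunction F U).
Notation locC := (loc_functor (weq MC)).
Notation locD := (loc_functor (weq MD)).
Notation HC := (localization (weq MC)).
Notation HD := (localization (weq MD)).
Notation lC := (fmap locC).
Notation lD := (fmap locD).

(* [K] is a class of cofibrant-like objects, [q x] a resolution of [x] in [K]. *)
Variable K : C -> Prop.
Variables (Q : C -> C) (q : forall x, hom (Q x) x).
Hypothesis KQ : forall x, K (Q x).
Hypothesis Wq : forall x, weq MC (q x).
Hypothesis lift_q : forall m x (v : hom m x), K m ->
  exists h : hom m (Q x), q x \oc h ~= v.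
Hypothesis W23 : two_of_three (weq MC).
Hypothesis Wsub : is_subcategory (weq MC).
Hypothesis WU : forall (x y : D) (f : hom x y), weq MD f <-> weq MC (fmap U f).
Hypothesis Wunit : forall m, K m -> weq MC (unit_ adj m).
(** Lifts through a resolution are unique only up to homotopy. This is the form of homotopy
    invariance that makes the choice of lifts harmless after [F] and localization. *)
Hypothesis F_lift_unique : forall m x (g g' : hom m (Q x)), K m ->
  q x \oc g ~= q x \oc g' -> fmap locD (fmap F g) ~= fmap locD (fmap F g').

(** Weak equivalences are detected by [U], and [U F f] is compared with [f] by units that are weak
    equivalences on [K]. *)
Lemma weq_F m n (f : hom m n) : K m -> K n -> weq MC f -> weq MD (fmap F f).
Proof.
move=> Km Kn Wf; apply/WU.
have [_ h _] := W23 (fmap U (fmap F f)) (unit_ adj m).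
apply: h; first exact: Wunit.
have [h _ c] := Wsub; apply: h (unit_nat adj f) _.
by apply: c => //; exact: Wunit.
Qed.

Definition Qmap x y (f : hom x y) : hom (Q x) (Q y) :=
  projT1 (cid (lift_q (f \oc q x) (KQ x))).

Lemma QmapP x y (f : hom x y) : q y \oc Qmap f ~= f \oc q x.
Proof. by rewrite /Qmap; case: (cid _). Qed.

(** The chosen lifts [Qmap] need not be functorial in [C]; [F_lift_unique] makes them so in
    [Ho MD]. *)
Definition FQ_functor : functor C (Ho MD).
refine (@Functor C (Ho MD) (fun x => F (Q x)) (fun x y f => lD (fmap F (Qmap f))) _ _ _).
- move=> x y f g fg; apply: (F_lift_unique (KQ x)).
  by rewrite !QmapP fg.
- move=> x; apply: heq_trans _ (fmap1 (fcomp locD F) (Q x)).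
  by apply: (F_lift_unique (KQ x)); rewrite QmapP comp1m compm1.
- move=> x y z g f; apply: heq_trans _ (fmapM (fcomp locD F) _ _).
  by apply: (F_lift_unique (KQ x)); rewrite compmA !QmapP -[X in _ ~= X]compmA QmapP compmA.
Defined.

Lemma FQ_weq x y (w : hom x y) : weq MC w -> is_iso (fmap FQ_functor w).
Proof.
move=> Ww; apply: loc_iso; apply: (weq_F (KQ x) (KQ y)).
have [_ _ h] := W23 (q y) (Qmap w); apply: h => //.
have [h _ c] := Wsub; apply: h (heq_sym (QmapP w)) _; exact: c.
Qed.

Definition LFQ : functor (Ho MC) (Ho MD) := loc_lift FQ_weq.

Lemma LFQ_trans_nat x y (f : hom x y) :
  lD (fmap F (q y)) \oc fmap LFQ (lC f) ~= lD (fmap F f) \oc lD (fmap F (q x)).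
Proof.
change (lD (fmap F (q y)) \oc lD (fmap F (Qmap f)) ~=
  lD (fmap F f) \oc lD (fmap F (q x))).
by rewrite -!fmapM QmapP.
Qed.

Definition LFQ_trans : nat_trans (LFQ \of locC) (locD \of F) :=
  @NatTrans _ _ (LFQ \of locC) (locD \of F) (fun x => lD (fmap F (q x)))
    LFQ_trans_nat.

(** Any [T] on the homotopy category inverts [q x], so a transformation out of it is determined by
    its values on resolutions; this forces the formula for [th]. *)
Lemma LFQ_derived : is_left_derived LFQ_trans.
Proof.
move=> T mu; change (functor HC HD) in T.
pose m x : hom (T (locC x)) (locD (F x)) := mu x.
have muN x y (f : hom x y) : m y \oc fmap T (lC f) ~= lD (fmap F f) \oc m x.
  exact: (naturality mu f).
have Tq x : is_iso (fmap T (lC (q x))) by apply: fmap_iso; exact: loc_iso.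
pose th x : hom (T (locC x)) (locD (F (Q x))) := m (Q x) \oc inv_iso (Tq x).
have thq x : th x \oc fmap T (lC (q x)) ~= m (Q x).
  by rewrite /th -compmA inv_isoK compm1.
have nat : forall (a b : Ho MC) (f : hom a b),
    (th b : hom (T b) (LFQ b)) \oc fmap T f ~= fmap LFQ f \oc th a.
  apply: (@loc_natural _ _ _ T LFQ th) => a b f.
  change (th b \oc fmap T (lC f) ~= lD (fmap F (Qmap f)) \oc th a).
  apply: (iso_epi (Tq a)).
  rewrite -2!compmA thq -muN -thq -compmA -!fmapM.
  by rewrite QmapP.
exists (@NatTrans _ _ T LFQ th nat); split=> [x|th' th'P x].
  change (lD (fmap F (q x)) \oc th x ~= m x).
  apply: (iso_epi (Tq x)).
  by rewrite -compmA thq muN.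
pose t x : hom (T (locC x)) (locD (F (Q x))) := th' x.
have tP y : lD (fmap F (q y)) \oc t y ~= m y by exact: th'P.
have tN y z (f : hom y z) : t z \oc fmap T (lC f) ~= lD (fmap F (Qmap f)) \oc t y.
  exact: (naturality th' (lC f)).
change (t x ~= th x).
apply: (iso_epi (Tq x)); rewrite thq tN.
(* [Qmap (q x)] and [q (Q x)] lift the same map through [q x], so they agree after [F] and
   localization. *)
rewrite -(tP (Q x)); apply: compm_heq => //.
by apply: F_lift_unique => //; rewrite QmapP.
Qed.

Definition RUQ : functor (Ho MD) (Ho MC) :=
  @loc_lift _ _ (weq MD) (locC \of U) (fun a b w Ww => loc_iso (proj1 (WU w) Ww)).

Lemma RUQ_trans_nat x y (f : hom x y) :
  idm (locC (U y)) \oc lC (fmap U f) ~= lC (fmap U f) \oc idm (locC (U x)).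
Proof. by rewrite comp1m compm1. Qed.

Definition RUQ_trans : nat_trans (locC \of U) (RUQ \of locD) :=
  @NatTrans _ _ (locC \of U) (RUQ \of locD) (fun x => idm (locC (U x)))
    RUQ_trans_nat.

Lemma RUQ_derived : is_right_derived RUQ_trans.
Proof.
move=> T mu; change (functor HD HC) in T.
pose m y : hom (locC (U y)) (T (locD y)) := mu y.
have nat : forall (a b : Ho MD) (f : hom a b),
    (m b : hom (RUQ b) (T b)) \oc fmap RUQ f ~= fmap T f \oc m a.
  apply: (@loc_natural _ _ _ RUQ T m) => a b f; exact: (naturality mu f).
exists (@NatTrans _ _ RUQ T m nat); split=> [y|th' th'P y].
  by change (m y \oc idm _ ~= m y); rewrite compm1.
pose t y : hom (locC (U y)) (T (locD y)) := th' y.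
have tP : t y \oc idm _ ~= m y by exact: th'P.
by change (t y ~= m y); rewrite -tP compm1.
Qed.

Definition derived_unit_map (x : C) : hom (locC x) (locC (U (F (Q x)))) :=
  lC (unit_ adj (Q x)) \oc inv_iso (loc_iso (Wq x)).

Definition derived_counit_map (y : D) : hom (locD (F (Q (U y)))) (locD y) :=
  lD (counit_ adj y \oc fmap F (q (U y))).

Lemma derived_unit_mapE x :
  derived_unit_map x \oc lC (q x) ~= lC (unit_ adj (Q x)).
Proof. by rewrite /derived_unit_map -compmA inv_isoK compm1. Qed.

Definition derived_LFRU : adjunction LFQ RUQ.
refine (@Adjunction _ _ LFQ RUQ derived_unit_map derived_counit_map _ _ _ _).
- apply: (loc_natural (S := idf _) (T := RUQ \of LFQ)) => x y f.
  apply: (iso_epi (loc_iso (Wq x))).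
  change (derived_unit_map y \oc lC f \oc lC (q x) ~=
    lC (fmap U (fmap F (Qmap f))) \oc derived_unit_map x \oc lC (q x)).
  rewrite -2!compmA derived_unit_mapE -(fmapM _ f) -QmapP (fmapM _ (q y)) compmA.
  by rewrite derived_unit_mapE -!fmapM unit_nat.
- apply: (loc_natural (S := LFQ \of RUQ) (T := idf _)) => x y f.
  change (derived_counit_map y \oc lD (fmap F (Qmap (fmap U f))) ~=
    lD f \oc derived_counit_map x).
  rewrite /derived_counit_map -!fmapM -compmA -(fmapM F) QmapP (fmapM F) compmA counit_nat.
  by rewrite compmA.
- move=> x.
  (* The triangle identity may be tested after precomposition with this isomorphism, where
     [derived_unit_mapE] absorbs the formal inverse of [q x]. *)
  have LFq : is_iso (lD (fmap F (Qmap (q x)))) := FQ_weq (Wq x).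
  apply: (iso_epi LFq).
  change (derived_counit_map (F (Q x)) \oc fmap LFQ (derived_unit_map x)
     \oc fmap LFQ (lC (q x)) ~= idm _ \oc lD (fmap F (Qmap (q x)))).
  rewrite -compmA -fmapM derived_unit_mapE comp1m.
  change (lD (counit_ adj (F (Q x)) \oc fmap F (q (U (F (Q x))))) \oc
    lD (fmap F (Qmap (unit_ adj (Q x)))) ~= lD (fmap F (Qmap (q x)))).
  rewrite -fmapM -compmA -(fmapM F) QmapP (fmapM F) compmA triangle_left comp1m.
  by apply: F_lift_unique => //; rewrite QmapP.
- move=> y.
  change (lC (fmap U (counit_ adj y \oc fmap F (q (U y)))) \oc
    (derived_unit_map (U y)) ~= idm (locC (U y))).
  rewrite /derived_unit_map compmA -fmapM (fmapM U) -compmA -unit_nat compmA.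
  by rewrite triangle_right comp1m inv_isoVK.
Defined.

Definition derived_pair : derived_adjunction MC MD adj.
refine (@DerivedAdjunction _ _ MC MD F U adj LFQ LFQ_trans LFQ_derived
  RUQ RUQ_trans RUQ_derived derived_LFRU _ _).
- move=> x.
  change (lC (fmap U (fmap F (q x))) \oc derived_unit_map x ~=
    idm (locC (U (F x))) \oc lC (unit_ adj x)).
  apply: (iso_epi (loc_iso (Wq x))).
  by rewrite -compmA derived_unit_mapE comp1m -!fmapM unit_nat.
- move=> y.
  change (derived_counit_map y \oc fmap LFQ (idm (locC (U y))) ~=
    lD (counit_ adj y) \oc lD (fmap F (q (U y)))).
  by rewrite fmap1 compm1 -fmapM.
Defined.

(** The unit is inverted because units on [K] are weak equivalences. For the counit, apply [U] and
    precompose with the unit at [Q (U y)]: by a triangle identity the result is [q (U y)], so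
    two-out-of-three applies. *)
Lemma derived_pair_equivalence : is_equivalence (LF_RU_adj derived_pair).
Proof.
split=> [x|y].
  apply: iso_comp; last exact: iso_inv.
  by apply: loc_iso; exact: Wunit.
apply: loc_iso; apply/WU.
have [_ h _] := W23 (fmap U (counit_ adj y \oc fmap F (q (U y)))) (unit_ adj (Q (U y))).
apply: h; first exact: Wunit.
have [h _ _] := Wsub; apply: h (Wq (U y)).
by rewrite fmapM -compmA -unit_nat compmA triangle_right comp1m.
Qed.

End DerivedEquivalence.

Local Open Scope ring_scope.

(** * Free modules *)

Section FreeModule.
Variables (R : pzRingType) (S : choiceType).

Definition fin_supported : {pred (S -> R^o)} := fun f =>
  `[< exists s : seq S, forall x, f x != 0 -> x \in s >].

Lemma fin_supported_closed : GRing.subsemimod_closed fin_supported.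
Proof.
split; [split|].
- by apply/asboolP; exists [::] => x; rewrite eqxx.
- move=> f g /asboolP[s fs] /asboolP[t gt]; apply/asboolP; exists (s ++ t) => x.
  rewrite mem_cat fctE => fg; apply/orP.
  have [f0|/fs] := eqVneq (f x) 0; last by left.
  by right; apply: gt; move: fg; rewrite f0 add0r.
- move=> a f /asboolP[s fs]; apply/asboolP; exists s => x.
  change (a *: f x != 0 -> x \in s).
  by move=> af; apply: fs; apply: contra_neq af => ->; rewrite scaler0.
Qed.

HB.instance Definition _ := GRing.isSubmodClosed.Build R _ fin_supported
  fin_supported_closed.

Record freemod := Freemod {
  free_fun : S -> R^o; free_funP : free_fun \in fin_supported }.

HB.instance Definition _ := [isSub for free_fun].
HB.instance Definition _ := [Choice of freemod by <:].
HB.instance Definition _ := GRing.SubChoice_isSubLmodule.Build R (S -> R^o)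
  fin_supported freemod fin_supported_closed.

Definition coef (f : freemod) (x : S) : R := free_fun f x.

Coercion coef : freemod >-> Funclass.
Arguments coef : simpl never.

Lemma free_funD (f g : freemod) x : (f + g) x = f x + g x. Proof. by []. Qed.
Lemma free_funZ a (f : freemod) x : (a *: f) x = a * f x. Proof. by []. Qed.

Lemma freemod_ext (f g : freemod) : f =1 g -> f = g.
Proof. by move=> /funext E; apply: val_inj. Qed.

Lemma delta_supported (x : S) : (fun y => (y == x)%:R : R^o) \in fin_supported.
Proof.
apply/asboolP; exists [:: x] => y; rewrite inE.
by case: (eqVneq y x) => //; rewrite eqxx.
Qed.

Definition delta (x : S) : freemod := Freemod (delta_supported x).

Lemma deltaE x y : delta x y = (y == x)%:R. Proof. by []. Qed.

Lemma free_support (f : freemod) : exists s : seq S,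
  uniq s /\ forall x, f x != 0 -> x \in s.
Proof.
have /asboolP[s fs] := free_funP f.
by exists (undup s); split=> [|x]; rewrite ?undup_uniq // mem_undup; exact: fs.
Qed.

Definition supp (f : freemod) : seq S := projT1 (cid (free_support f)).

Lemma free_funS (I : Type) (r : seq I) (F : I -> freemod) y :
  (\sum_(i <- r) F i) y = \sum_(i <- r) F i y.
Proof. by elim/big_ind2: _ => // f a g b fa gb; rewrite free_funD fa gb. Qed.

Lemma freemod_sum (f : freemod) (s : seq S) : uniq s ->
  (forall x, f x != 0 -> x \in s) -> f = \sum_(x <- s) f x *: delta x.
Proof.
move=> us fs; apply: freemod_ext => y; rewrite free_funS.
have [ys|ys] := boolP (y \in s).
  rewrite (bigD1_seq y) // free_funZ deltaE eqxx mulr1 big1; first exact/esym/addr0.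
  by move=> x; rewrite free_funZ deltaE eq_sym => /negPf ->; rewrite mulr0.
rewrite big_seq big1 => [|x xs].
  by apply/eqP; apply: contraNT ys => /fs.
rewrite free_funZ deltaE; case: eqVneq => [yx|]; last by rewrite mulr0.
by rewrite yx xs in ys.
Qed.

(** A list of coefficients and generators is the form in which a [cell] below stores a combination
    of other cells. *)
Lemma freemod_gen (f : freemod) : exists s : seq (R * S),
  f = \sum_(u <- s) u.1 *: delta u.2.
Proof.
have [s [us fs]] := free_support f.
exists [seq (f x, x) | x <- s]; rewrite big_map /=; exact: freemod_sum.
Qed.

Section Lift.
Variables (M : lmodType R) (phi : S -> M).

Definition free_lift (f : freemod) : M := \sum_(x <- supp f) f x *: phi x.

(** Two lists covering the support differ only by generators with coefficient zero, so the chosen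
    list [supp f] may be replaced by any other. *)
Lemma free_liftE (f : freemod) (s : seq S) : uniq s ->
  (forall x, f x != 0 -> x \in s) -> free_lift f = \sum_(x <- s) f x *: phi x.
Proof.
move=> us fs; rewrite /free_lift /supp; case: (cid _) => t /= [ut ft].
rewrite (bigID (fun x => f x == 0)) /= big1 ?add0r => [|x /eqP ->]; last by rewrite scale0r.
rewrite [RHS](bigID (fun x => f x == 0)) /= [in RHS]big1 ?add0r => [|x /eqP ->]; last by rewrite scale0r.
rewrite -[LHS]big_filter -[RHS]big_filter; apply: perm_big.
apply: uniq_perm; rewrite ?filter_uniq // => x; rewrite !mem_filter.
by case: eqP => //= /eqP fx; rewrite ft ?fs.
Qed.

Lemma free_lift_linear : linear free_lift.
Proof.
move=> a f g; have [s [us fs]] := free_support f; have [t [ut gt]] := free_support g.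
have f0 x : f x != 0 -> x \in undup (s ++ t).
  by rewrite mem_undup mem_cat => /fs ->.
have g0 x : g x != 0 -> x \in undup (s ++ t).
  by rewrite mem_undup mem_cat => /gt ->; rewrite orbT.
have fg0 x : (a *: f + g) x != 0 -> x \in undup (s ++ t).
  rewrite free_funD free_funZ => h.
  have [fx|/f0 //] := eqVneq (f x) 0; apply: g0.
  by move: h; rewrite fx mulr0 add0r.
have st := undup_uniq (s ++ t).
rewrite (free_liftE st f0) (free_liftE st g0) (free_liftE st fg0).
rewrite scaler_sumr -big_split /=; apply: eq_bigr => x _.
by rewrite free_funD free_funZ scalerDl scalerA.
Qed.

HB.instance Definition _ := GRing.isLinear.Build R freemod M _ free_lift free_lift_linear.

Lemma free_lift_delta x : free_lift (delta x) = phi x.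
Proof.
rewrite (@free_liftE _ [:: x]) ?big_seq1 ?deltaE ?eqxx ?scale1r // => y.
by rewrite inE deltaE; case: (eqVneq y x) => //; rewrite eqxx.
Qed.

End Lift.

Lemma free_ext (M : lmodType R) (f g : {linear freemod -> M}) :
  (forall x, f (delta x) = g (delta x)) -> f =1 g.
Proof.
move=> fg z; have [s ->] := freemod_gen z; rewrite !linear_sum.
by apply: eq_bigr => u _; rewrite !linearZ fg.
Qed.

End FreeModule.

Arguments delta {R S}.
Arguments free_lift {R S M}.

(** * Complexes of modules *)

Section QuasiIso.
Variable R : pzRingType.
Implicit Types M N P : Ch (Mod R).

Lemma dif_dif M n (z : (M (n + 1 + 1) : lmodType R)) : dif M n (dif M (n + 1) z) = 0.
Proof. exact: (cx_dd M n z). Qed.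

Lemma chain_dif M N (f : hom M N) n (z : (M (n + 1) : lmodType R)) :
  dif N n (chain_fun f (n + 1) z) = chain_fun f n (dif M n z).
Proof. exact: (chain_d f n z). Qed.

Lemma chain_compE M N P (g : hom N P) (f : hom M N) n (z : (M n : lmodType R)) :
  chain_fun (g \oc f) n z = chain_fun g n (chain_fun f n z).
Proof. by []. Qed.

Definition boundary M n (z : (M (n + 1) : lmodType R)) : Prop :=
  exists y, z = dif M (n + 1) y.

Lemma boundaryD M n (z w : (M (n + 1) : lmodType R)) :
  boundary z -> boundary w -> boundary (z + w).
Proof. by move=> [x ->] [y ->]; exists (x + y); rewrite linearD. Qed.

Lemma boundaryN M n (z : (M (n + 1) : lmodType R)) : boundary z -> boundary (- z).
Proof. by move=> [x ->]; exists (- x); rewrite linearN. Qed.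

Lemma boundary_map M N (f : hom M N) n (z : (M (n + 1) : lmodType R)) :
  boundary z -> boundary (chain_fun f (n + 1) z).
Proof. by move=> [x ->]; exists (chain_fun f _ x); rewrite chain_dif. Qed.

Lemma cycle_map M N (f : hom M N) n (z : (M (n + 1) : lmodType R)) :
  cycle z -> cycle (chain_fun f (n + 1) z).
Proof. by move=> zc; rewrite /cycle chain_dif zc linear0. Qed.

Lemma cycleB M n (z w : (M (n + 1) : lmodType R)) : cycle z -> cycle w -> cycle (z - w).
Proof. by rewrite /cycle linearB => -> ->; rewrite subr0. Qed.

Lemma quasi_isoP M N (f : hom M N) : quasi_iso f <-> forall n,
  (forall z, cycle z -> boundary (chain_fun f (n + 1) z) -> boundary z) /\
  (forall w : (N (n + 1) : lmodType R), cycle w ->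
     exists2 z, cycle z & boundary (chain_fun f (n + 1) z - w)).
Proof.
split=> h n; have [inj surj] := h n; split=> //; last first.
  by move=> z z' zc z'c; rewrite /homologous -linearB; apply: inj; exact: cycleB.
move=> z zc [y fz].
have [||y' e] := inj z 0 zc; rewrite ?/cycle ?linear0 //.
  by exists y; rewrite subr0.
by exists y'; rewrite -e subr0.
Qed.

Lemma quasi_iso_heq M N (f g : hom M N) : f ~= g -> quasi_iso f -> quasi_iso g.
Proof.
move=> fg /quasi_isoP h; apply/quasi_isoP => n.
have E z : chain_fun g (n + 1) z = chain_fun f (n + 1) z by exact/esym/(fg (n + 1)).
have [inj surj] := h n; split=> [z|w /surj[z zc b]]; first by rewrite E; exact: inj.
by exists z; rewrite ?E.
Qed.

Lemma quasi_iso_id M : quasi_iso (idm M).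
Proof.
apply/quasi_isoP => n; split=> // w wc; exists w => //.
by exists 0; rewrite linear0 subrr.
Qed.

Lemma quasi_iso_two_of_three : two_of_three (@quasi_iso R).
Proof.
move=> M N P g f; split=> /quasi_isoP h1 /quasi_isoP h2; apply/quasi_isoP => n.
- have [[f_inj f_surj] [g_inj g_surj]] := (h1 n, h2 n); split=> [z zc|w wc].
    by move=> /(g_inj _ (cycle_map f zc)); exact: f_inj.
  have [y yc gy] := g_surj w wc; have [z zc fz] := f_surj y yc.
  exists z => //; have := boundaryD (boundary_map g fz) gy.
  by rewrite linearB addrA subrK.
- have [[f_inj f_surj] [gf_inj gf_surj]] := (h1 n, h2 n); split=> [y yc gy|w wc].
    have [z zc fz] := f_surj y yc.
    have /(gf_inj z zc)/(boundary_map f) : boundary (chain_fun (g \oc f) (n + 1) z).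
      have := boundaryD (boundary_map g fz) gy.
      by rewrite linearB subrK.
    by move=> /boundaryD/(_ (boundaryN fz)); rewrite opprB addrC subrK.
  have [z zc gfz] := gf_surj w wc.
  by exists (chain_fun f (n + 1) z) => //; exact: cycle_map.
- have [[g_inj g_surj] [gf_inj gf_surj]] := (h1 n, h2 n); split=> [z zc fz|y yc].
    by apply: gf_inj => //; exact: (boundary_map g fz).
  have [z zc gfz] := gf_surj _ (cycle_map g yc); exists z => //.
  apply: g_inj; last by rewrite linearB.
  by apply: cycleB => //; exact: cycle_map.
Qed.

Lemma quasi_iso_subcategory : is_subcategory (@quasi_iso R).
Proof.
split=> [M N f g|M|M N P g f qg qf]; [exact: quasi_iso_heq|exact: quasi_iso_id|].
by have [h _ _] := quasi_iso_two_of_three g f; exact: h.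
Qed.

Lemma quasi_iso_retract : retract_closed (@quasi_iso R).
Proof.
move=> M N M' N' f g [s [r [s' [r' [rs rs' gs fr]]]]] /quasi_isoP h.
have rsE n z : chain_fun r n (chain_fun s n z) = z := rs n z.
have rsE' n z : chain_fun r' n (chain_fun s' n z) = z := rs' n z.
have gsE n z : chain_fun g n (chain_fun s n z) = chain_fun s' n (chain_fun f n z) := gs n z.
have frE n z : chain_fun f n (chain_fun r n z) = chain_fun r' n (chain_fun g n z) := fr n z.
apply/quasi_isoP => n; have [inj surj] := h n; split=> [z zc fz|w wc].
  rewrite -[z]rsE; apply: boundary_map; apply: inj; first exact: cycle_map.
  by rewrite gsE; exact: boundary_map.
have [x xc gx] := surj _ (cycle_map s' wc).
exists (chain_fun r _ x); first exact: cycle_map.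
by rewrite frE -[w]rsE' -linearB; exact: boundary_map.
Qed.

Lemma surjection_subcategory : is_subcategory (@surjection R).
Proof.
split=> [M N f g fg sf|M|M N P g f sg sf] n y.
- by have [x <-] := sf n y; exists x; exact/esym/(fg n).
- by exists y.
- by have [x <-] := sg n y; have [z <-] := sf n x; exists z.
Qed.

Lemma surjection_retract : retract_closed (@surjection R).
Proof.
move=> M N M' N' f g [s [r [s' [r' [rs rs' gs fr]]]]] sg n y.
have [x gx] := sg n (chain_fun s' n y); exists (chain_fun r n x).
have -> : chain_fun f n (chain_fun r n x) = chain_fun r' n (chain_fun g n x) := fr n x.
by rewrite gx; exact: (rs' n y).
Qed.

Lemma bijective_quasi_iso M N (f : hom M N) :
  (forall n, bijective (chain_fun f n)) -> quasi_iso f.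
Proof.
move=> bf; apply/quasi_isoP => n; split=> [z _ [y fz]|w wc].
  have [h fh hf] := bf (n + 1 + 1); exists (h y).
  by apply: (bij_inj (bf (n + 1))); rewrite fz -chain_dif hf.
have [h fh hf] := bf (n + 1); exists (h w); last first.
  by exists 0; rewrite linear0 hf subrr.
apply: (bij_inj (bf n)); rewrite -chain_dif hf linear0; exact: wc.
Qed.

(** Cycles, homology and sphere liftings live in degrees written [n + 1]; this brings an arbitrary
    degree to that form. *)
Lemma int_succ (k : int) : exists n, k = n + 1.
Proof. by exists (k - 1); rewrite subrK. Qed.

(* the lifting property against the inclusions of spheres into discs *)
Definition sphere_lifting M N (f : hom M N) : Prop :=
  forall n (z : (M (n + 1) : lmodType R)) (y : (N (n + 1 + 1) : lmodType R)),
    dif M n z = 0 -> dif N (n + 1) y = chain_fun f (n + 1) z ->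
    exists x, dif M (n + 1) x = z /\ chain_fun f (n + 1 + 1) x = y.

(** Start from any chain bounding [z] and correct it twice: by a cycle [w], which repairs its image
    up to the boundary of some [e], and by the boundary of a lift of [e]. *)
Lemma sphere_lifting_triv_fib M N (f : hom M N) :
  surjection f -> quasi_iso f -> sphere_lifting f.
Proof.
move=> sf /quasi_isoP qf n z y zc yz.
have [x xz] : boundary z by case: (qf n) => inj _; apply: inj => //; exists y.
have [x' fx'] := sf _ (y - chain_fun f _ x).
have cyc : cycle (y - chain_fun f (n + 1 + 1) x).
  by rewrite /cycle linearB chain_dif yz xz subrr.
have [_ surj] := qf (n + 1); have [w wc [e we]] := surj _ cyc.
have [e' fe'] := sf _ e.
exists (x + w - dif M _ e'); split.
  by rewrite linearB linearD dif_dif subr0 wc addr0.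
rewrite linearB linearD -chain_dif fe' -we opprB -[y - _ - _]addrA -opprD addrCA subrr addr0.
by [].
Qed.

Lemma sphere_lifting_cycle M N (f : hom M N) n (y : (N (n + 1 + 1) : lmodType R)) :
  sphere_lifting f -> dif N (n + 1) y = 0 ->
  exists x, dif M (n + 1) x = 0 /\ chain_fun f (n + 1 + 1) x = y.
Proof. by move=> lf yc; apply: lf; rewrite ?linear0. Qed.

Lemma sphere_lifting_surj M N (f : hom M N) : sphere_lifting f -> surjection f.
Proof.
(* Three successors are split off because the boundary of [y] is first lifted as a cycle, one degree
   lower. *)
move=> lf k; have [j ->] := int_succ k; have [i ->] := int_succ j.
have [n ->] := int_succ i => y.
have [z [zc fz]] := sphere_lifting_cycle lf (dif_dif y).
by have [x [_ <-]] := lf _ _ y zc (esym fz); exists x.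
Qed.

Lemma sphere_lifting_quasi_iso M N (f : hom M N) : sphere_lifting f -> quasi_iso f.
Proof.
move=> lf; apply/quasi_isoP => n; split=> [z zc [y fz]|].
  by have [x [<- _]] := lf _ z y zc (esym fz); exists x.
have [i ->] := int_succ n => w wc.
have [z [zc fz]] := sphere_lifting_cycle lf wc; exists z => //.
by exists 0; rewrite linear0 fz subrr.
Qed.

End QuasiIso.

(** * Extensions of complexes with a twisted differential *)

Section Twist.
Variable R : pzRingType.

(** A degreewise split extension of [A], given by its quotient and by the off-diagonal part [tw_tau]
    of the differential. The two equations say that [twist_d] squares to zero. *)
Record twisting (A : Ch (Mod R)) := Twisting {
  tw_obj : int -> lmodType R;
  tw_tau : forall n, {linear tw_obj (n + 1) -> (A n : lmodType R)};
  tw_d : forall n, {linear tw_obj (n + 1) -> tw_obj n};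
  tw_tau_d : forall n x, dif A n (tw_tau (n + 1) x) + tw_tau n (tw_d (n + 1) x) = 0;
  tw_dd : forall n x, tw_d n (tw_d (n + 1) x) = 0 }.

Section TwistComplex.
Variables (A : Ch (Mod R)) (T : twisting A).
Notation P := (tw_obj T).

Definition twist_obj n : lmodType R := ((A n : lmodType R) * P n)%type.

Definition twist_d n (z : twist_obj (n + 1)) : twist_obj n :=
  (dif A n z.1 + tw_tau T n z.2, tw_d T n z.2).

Lemma twist_d_linear n : linear (@twist_d n).
Proof.
move=> a [x y] [x' y']; apply: injective_projections; last exact: linearP.
by rewrite /= !linearP /= scalerDr addrACA.
Qed.

HB.instance Definition _ n := GRing.isLinear.Build R
  (twist_obj (n + 1)) (twist_obj n) _
  (@twist_d n) (@twist_d_linear n).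

Lemma twist_dd n z : twist_d (twist_d z) = 0 :> twist_obj n.
Proof.
by rewrite /twist_d /= linearD /= dif_dif add0r tw_tau_d tw_dd.
Qed.

Definition twist : Ch (Mod R) :=
  @Complex (Mod R) twist_obj
    (fun n => @twist_d n : {linear _ -> _}) (fun n z => twist_dd z).

Lemma twist_dE n (a : (A (n + 1) : lmodType R)) (x : P (n + 1)) :
  dif twist n (a, x) = (dif A n a + tw_tau T n x, tw_d T n x).
Proof. by []. Qed.

Definition twist_inl n (a : (A n : lmodType R)) : twist_obj n := (a, 0).
Definition twist_inr n (x : P n) : twist_obj n := (0, x).

Lemma twist_inl_linear n : linear (@twist_inl n).
Proof. by move=> a x y; apply: injective_projections => //=; rewrite scaler0 addr0. Qed.

Lemma twist_inr_linear n : linear (@twist_inr n).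
Proof. by move=> a x y; apply: injective_projections => //=; rewrite scaler0 addr0. Qed.

HB.instance Definition _ n := GRing.isLinear.Build R
  (A n : lmodType R) (twist_obj n) _
  (@twist_inl n) (@twist_inl_linear n).
HB.instance Definition _ n := GRing.isLinear.Build R
  (P n) (twist_obj n) _ (@twist_inr n) (@twist_inr_linear n).

Lemma twist_in_d n (a : (A (n + 1) : lmodType R)) :
  dif twist n (a, 0) = (dif A n a, 0).
Proof. by rewrite twist_dE !linear0 addr0. Qed.

Definition twist_in : hom A twist :=
  @ChainMap (Mod R) A twist (fun n => @twist_inl n : {linear _ -> _}) twist_in_d.

Lemma twist_inE n a : chain_fun twist_in n a = (a, 0). Proof. by []. Qed.

Section TwistMap.
Variables (Y : Ch (Mod R)) (u : hom A Y).
Variable phi : forall n, {linear P n -> (Y n : lmodType R)}.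
Hypothesis phi_d : forall n x,
  dif Y n (phi (n + 1) x) = chain_fun u n (tw_tau T n x) + phi n (tw_d T n x).

Definition twist_fun n (z : twist_obj n) : (Y n : lmodType R) :=
  chain_fun u n z.1 + phi n z.2.

Lemma twist_fun_linear n : linear (@twist_fun n).
Proof.
by move=> a [x y] [x' y']; rewrite /twist_fun /= !linearP /= scalerDr addrACA.
Qed.

HB.instance Definition _ n := GRing.isLinear.Build R
  (twist_obj n) (Y n : lmodType R) _
  (@twist_fun n) (@twist_fun_linear n).

Lemma twist_fun_d n (z : (twist (n + 1) : lmodType R)) :
  dif Y n (twist_fun z) = twist_fun (dif twist n z).
Proof.
case: z => a x; rewrite twist_dE /twist_fun /= !linearD /= phi_d chain_dif.
by rewrite !addrA.
Qed.

Definition twist_map : hom twist Y :=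
  @ChainMap (Mod R) twist Y (fun n => @twist_fun n : {linear _ -> _}) twist_fun_d.

Lemma twist_mapE n a x : chain_fun twist_map n (a, x) = chain_fun u n a + phi n x.
Proof. by []. Qed.

Lemma twist_map_in : twist_map \oc twist_in ~= u.
Proof.
move=> n a; change (chain_fun u n a + phi n 0 = chain_fun u n a).
by rewrite linear0 addr0.
Qed.

End TwistMap.

Lemma twist_ext (Y : Ch (Mod R)) (g h : hom twist Y) :
  g \oc twist_in ~= h \oc twist_in ->
  (forall n x, chain_fun g n (0, x) = chain_fun h n (0, x)) -> g ~= h.
Proof.
move=> gh1 gh2 n [a x].
change (chain_fun g n (a, x) = chain_fun h n (a, x)).
have -> : (a, x) = (a, 0) + (0, x) :> twist_obj n.
  by apply: injective_projections; rewrite /= ?addr0 ?add0r.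
by rewrite !linearD gh2; congr (_ + _); exact: (gh1 n a).
Qed.

End TwistComplex.

Section DirectSum.
Variables M N : Ch (Mod R).

Lemma dsum_tau_d n (x : (N (n + 1 + 1) : lmodType R)) :
  dif M n ((\0 : {linear (N (n + 1 + 1) : lmodType R) -> (M (n + 1) : lmodType R)}) x) +
  (\0 : {linear (N (n + 1) : lmodType R) -> (M n : lmodType R)}) (dif N (n + 1) x) = 0.
Proof. by rewrite /= linear0 addr0. Qed.

Definition dsum_twisting : twisting M :=
  @Twisting M (fun n => (N n : lmodType R)) (fun n => \0) (dif N)
    dsum_tau_d (@dif_dif R N).

Definition dsum : Ch (Mod R) := twist dsum_twisting.

Definition dsum_inl : hom M dsum := twist_in dsum_twisting.

Lemma dsum_inr_d n (x : (N (n + 1) : lmodType R)) :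
  dif dsum n (0, x) = (0, dif N n x).
Proof. by rewrite twist_dE linear0 addr0. Qed.

Definition dsum_inr : hom N dsum :=
  @ChainMap (Mod R) N dsum (fun n => @twist_inr M dsum_twisting n :
    {linear tw_obj dsum_twisting n -> twist_obj dsum_twisting n}) dsum_inr_d.

Lemma dsum_rec_d Y (u : hom M Y) (v : hom N Y) n (x : (N (n + 1) : lmodType R)) :
  dif Y n (chain_fun v (n + 1) x) =
  chain_fun u n ((\0 : {linear (N (n + 1) : lmodType R) -> (M n : lmodType R)}) x) +
  chain_fun v n (dif N n x).
Proof. by rewrite /= linear0 add0r chain_dif. Qed.

Definition dsum_rec Y (u : hom M Y) (v : hom N Y) : hom dsum Y :=
  @twist_map M dsum_twisting Y u (chain_fun v) (dsum_rec_d u v).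

Lemma dsum_rec_inl Y (u : hom M Y) (v : hom N Y) : dsum_rec u v \oc dsum_inl ~= u.
Proof. exact: twist_map_in. Qed.

Lemma dsum_rec_inr Y (u : hom M Y) (v : hom N Y) : dsum_rec u v \oc dsum_inr ~= v.
Proof.
move=> n x; change (chain_fun u n 0 + chain_fun v n x = chain_fun v n x).
by rewrite linear0 add0r.
Qed.

Lemma dsum_ext Y (g h : hom dsum Y) : g \oc dsum_inl ~= h \oc dsum_inl ->
  g \oc dsum_inr ~= h \oc dsum_inr -> g ~= h.
Proof. by move=> gl gr; apply: twist_ext => // n x; exact: (gr n x). Qed.

End DirectSum.

(** The free module on the empty type has a single element, so the identity serves as the zero
    differential. *)
Definition zero_complex : Ch (Mod R) :=
  @Complex (Mod R) (fun n => freemod R void) (fun n => idfun)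
    (fun n z => freemod_ext (fun x : void => match x with end)).

Lemma zero_complex_el n (z w : (zero_complex n : lmodType R)) : z = w.
Proof. by apply: freemod_ext; case. Qed.

Lemma zero_complex_rec_d (M : Ch (Mod R)) n (z : (zero_complex (n + 1) : lmodType R)) :
  dif M n ((\0 : {linear (zero_complex (n + 1) : lmodType R) -> (M (n + 1) : lmodType R)}) z) =
  (\0 : {linear (zero_complex n : lmodType R) -> (M n : lmodType R)}) (dif zero_complex n z).
Proof. exact: linear0. Qed.

Definition zero_complex_rec (M : Ch (Mod R)) : hom zero_complex M :=
  @ChainMap (Mod R) zero_complex M (fun n => \0) (@zero_complex_rec_d M).

Lemma zero_complex_initial : is_initial zero_complex.
Proof.
move=> M; exists (zero_complex_rec M) => g n z.
by rewrite (zero_complex_el z 0) /= linear0.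
Qed.

End Twist.

(** * Factorizations *)

Section CellFactorization.
Variables (R : pzRingType) (A B : Ch (Mod R)) (f : hom A B).

(** Equality with a [freemod], rather than isomorphism, so that statements about free modules apply
    by rewriting. *)
Definition free_twisting (T : twisting A) : Prop :=
  forall n, exists S : choiceType, tw_obj T n = freemod R S.

(* [Cell n a s y] is a generator attached in degree [n + 2] to the cycle given by [a]
   and the formal combination [s] of cells, and sent to [y]. The nesting replaces the
   transfinite composition of cell attachments. The degree is not part of the type:
   every cell is a generator in all degrees, with zero boundary and zero image unless
   the degree is [n + 2] and the data are [admissible]. *)
Inductive cell : Type :=
  Cell (n : int) (a : (A (n + 1) : lmodType R)) (s : seq (R * cell))
    (y : (B (n + 1 + 1) : lmodType R)).

HB.instance Definition _ := gen_eqMixin cell.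
HB.instance Definition _ := gen_choiceMixin cell.

(** Induction that also covers the cells inside the list [s], which the generated principle
    ignores. *)
Lemma cell_nested_ind (P : cell -> Prop) :
  (forall n a s y, (forall u, u \in s -> P u.2) -> P (@Cell n a s y)) ->
  forall g, P g.
Proof.
move=> H; fix IH 1 => -[n a s y]; apply: H.
(* [IH] is cleared so that the goal closes by the empty membership and not by an unguarded recursive
   call. *)
elim: s => [|v s IHs] u; first by clear IH.
by rewrite inE => /predU1P[->|/IHs //]; exact: IH.
Qed.

Definition combination (s : seq (R * cell)) : freemod R cell :=
  \sum_(u <- s) u.1 *: delta u.2.

Lemma free_lift_combination (M : lmodType R) (phi : cell -> M) s :
  free_lift phi (combination s) = \sum_(u <- s) u.1 *: phi u.2.
Proof.
rewrite /combination linear_sum; apply: eq_bigr => u _.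
by rewrite linearZ /= free_lift_delta.
Qed.

Definition cell_target n : lmodType R := ((A n : lmodType R) * freemod R cell)%type.

(** Admissibility of a cell depends on the boundaries and images of the cells nested in it, so both
    are computed together by recursion. The conditions spell out [admissible] below, whose
    ingredients are themselves built from this function. *)
Fixpoint cell_eval (g : cell) :
    (forall m, cell_target m) * (forall m, (B m : lmodType R)) :=
  let: Cell n a s y := g in
  let s' := [seq (u.1, cell_eval u.2) | u <- s] in
  let admissible := `[<
    [/\ dif A n a + \sum_(w <- s') w.1 *: (w.2.1 n).1 = 0,
        \sum_(w <- s') w.1 *: (w.2.1 n).2 = 0 &
        chain_fun f (n + 1) a + \sum_(w <- s') w.1 *: w.2.2 (n + 1) =
          dif B (n + 1) y] >] in
  (fun m => match n + 1 =P m with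
    | ReflectT e => if admissible
        then ecast i (cell_target i) e (a, \sum_(u <- s) u.1 *: delta u.2) else 0
    | ReflectF _ => 0 end,
   fun m => match n + 1 + 1 =P m with
    | ReflectT e => if admissible then ecast i (B i : lmodType R) e y else 0
    | ReflectF _ => 0 end).

(** Mind the shift: [cell_bd g m] is the boundary of the copy of [g] in degree [m + 1], whereas
    [cell_val g m] is the image of its copy in degree [m]. *)
Definition cell_bd (g : cell) m : cell_target m := (cell_eval g).1 m.
Definition cell_val (g : cell) m : (B m : lmodType R) := (cell_eval g).2 m.

Definition cell_tau n : freemod R cell -> (A n : lmodType R) :=
  free_lift (fun g => (cell_bd g n).1).
Definition cell_d n : freemod R cell -> freemod R cell :=
  free_lift (fun g => (cell_bd g n).2).
Definition cell_map n : freemod R cell -> (B n : lmodType R) :=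
  free_lift (fun g => cell_val g n).

HB.instance Definition _ n := GRing.Linear.copy (cell_tau n) (free_lift _).
HB.instance Definition _ n := GRing.Linear.copy (cell_d n) (free_lift _).
HB.instance Definition _ n := GRing.Linear.copy (cell_map n) (free_lift _).

(** These are the sphere lifting problems for [cell_fib]: [(a, x)] is a cycle of the extension and
    [y] bounds its image. *)
Definition admissible n (a : (A (n + 1) : lmodType R)) (x : freemod R cell)
    (y : (B (n + 1 + 1) : lmodType R)) : Prop :=
  [/\ dif A n a + cell_tau n x = 0, cell_d n x = 0 &
      chain_fun f (n + 1) a + cell_map (n + 1) x = dif B (n + 1) y].

Lemma cell_admissible n a s y : admissible a (combination s) y ->
  cell_bd (@Cell n a s y) (n + 1) = (a, combination s) /\
  cell_val (@Cell n a s y) (n + 1 + 1) = y.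
Proof.
rewrite /admissible /cell_tau /cell_d /cell_map !free_lift_combination => adm.
rewrite /cell_bd /cell_val /= !big_map /=.
case: eqP => // e; case: eqP => // e'.
by rewrite (eq_irrelevance e erefl) (eq_irrelevance e' erefl) asboolT.
Qed.

Lemma cell_inadmissible n a s y m : ~ (admissible a (combination s) y /\ n = m) ->
  cell_bd (@Cell n a s y) (m + 1) = 0 /\ cell_val (@Cell n a s y) (m + 1 + 1) = 0.
Proof.
rewrite /admissible /cell_tau /cell_d /cell_map !free_lift_combination => adm.
rewrite /cell_bd /cell_val /= !big_map /=.
split; case: eqP => // e; rewrite asboolF // => h; apply: adm; split=> //.
  exact: addIr e.
by apply: addIr (1 : int) _ _ _; exact: addIr e.
Qed.

(** For an admissible cell in its own degree these equations are the admissibility conditions; in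
    every other case all terms vanish. *)
Lemma cell_twist_bd n (g : cell) :
  (dif A n (cell_bd g (n + 1)).1 + cell_tau n (cell_bd g (n + 1)).2 = 0 /\
   cell_d n (cell_bd g (n + 1)).2 = 0) /\
  chain_fun f (n + 1) (cell_bd g (n + 1)).1 + cell_map (n + 1) (cell_bd g (n + 1)).2 =
    dif B (n + 1) (cell_val g (n + 1 + 1)).
Proof.
case: g => m a s y.
have [[adm <-]|h] := pselect (admissible a (combination s) y /\ m = n).
  by have [-> ->] := cell_admissible adm; case: adm.
by have [-> ->] := cell_inadmissible h; rewrite /= !linear0 !addr0.
Qed.

Lemma cell_tau_d n x :
  dif A n (cell_tau (n + 1) x) + cell_tau n (cell_d (n + 1) x) = 0.
Proof.
apply: (@free_ext _ _ _ ((dif A n \o cell_tau (n + 1)) \+ (cell_tau n \o cell_d (n + 1))) \0) => g.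
rewrite /= [cell_tau (n + 1) _]free_lift_delta [cell_d (n + 1) _]free_lift_delta.
by have [[-> _] _] := cell_twist_bd n g.
Qed.

Lemma cell_dd n x : cell_d n (cell_d (n + 1) x) = 0.
Proof.
apply: (@free_ext _ _ _ (cell_d n \o cell_d (n + 1)) \0) => g.
rewrite /= [cell_d (n + 1) _]free_lift_delta.
by have [[_ ->] _] := cell_twist_bd n g.
Qed.

Definition cell_twisting : twisting A :=
  @Twisting _ A (fun _ => freemod R cell) cell_tau cell_d cell_tau_d cell_dd.

Lemma cell_map_d n x : dif B n (cell_map (n + 1) x) =
  chain_fun f n (cell_tau n x) + cell_map n (cell_d n x).
Proof.
have [m ->] := int_succ n.
apply: (@free_ext _ _ _ (dif B (m + 1) \o cell_map (m + 1 + 1))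
  ((chain_fun f (m + 1) \o cell_tau (m + 1)) \+ (cell_map (m + 1) \o cell_d (m + 1)))) => g.
rewrite /= [cell_map (m + 1 + 1) _]free_lift_delta.
rewrite [cell_tau _ _]free_lift_delta [cell_d _ _]free_lift_delta.
by have [_ ->] := cell_twist_bd m g.
Qed.

Definition cell_fib : hom (twist cell_twisting) B :=
  @twist_map _ A cell_twisting B f cell_map cell_map_d.

(** A lifting problem is literally the data of an admissible cell, and the generator on that cell
    solves it. *)
Lemma cell_fib_lifting : sphere_lifting cell_fib.
Proof.
move=> n [a x] y zc yz; have [s xs] := freemod_gen x.
have adm : admissible a (combination s) y.
  rewrite /combination -xs; split; last by rewrite yz.
    exact: (congr1 fst zc).
  exact: (congr1 snd zc).
have [bd val] := cell_admissible adm.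
exists (0, delta (@Cell n a s y)); split.
  rewrite twist_dE linear0 add0r /=.
  rewrite [cell_tau _ _]free_lift_delta [cell_d _ _]free_lift_delta bd.
  by rewrite /= xs.
by rewrite twist_mapE linear0 add0r /= [cell_map _ _]free_lift_delta.
Qed.

Section CellLift.
Variables (X Y : Ch (Mod R)) (q : hom X Y) (u : hom A X) (v : hom (twist cell_twisting) Y).
Hypothesis lq : sphere_lifting q.
Hypothesis quv : q \oc u ~= v \oc twist_in cell_twisting.

(** The boundary of a cell involves only cells nested in it, so [target], the boundary required of
    the lift, is known by recursion. [xget] chooses a solution with default 0; that one exists is
    shown in [cell_liftP]. Quantifying over [e] gives the degree [m] the shape to which the
    differential applies. *)
Fixpoint cell_lift (g : cell) : forall m, (X m : lmodType R) :=
  let: Cell n a s y := g in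
  let s' := [seq (u.1, cell_lift u.2) | u <- s] in
  let target k : (X (k + 1) : lmodType R) :=
    chain_fun u (k + 1) (cell_bd g (k + 1)).1 +
    if `[< admissible a (combination s) y /\ n = k >]
    then \sum_(w <- s') w.1 *: w.2 (k + 1) else 0 in
  fun m => xget 0 [set x | chain_fun q m x = chain_fun v m (0, delta g) /\
    forall k (e : m = k + 1 + 1),
      dif X (k + 1) (ecast i (X i : lmodType R) e x) = target k].

Definition cell_lift_map n : freemod R cell -> (X n : lmodType R) :=
  free_lift (fun g => cell_lift g n).

HB.instance Definition _ n := GRing.Linear.copy (cell_lift_map n) (free_lift _).

Definition cell_ext n (z : cell_target n) : (X n : lmodType R) :=
  chain_fun u n z.1 + cell_lift_map n z.2.

Lemma twist_delta_d n g : dif (twist cell_twisting) n (0, delta g) = cell_bd g n.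
Proof.
rewrite twist_dE linear0 add0r /= [cell_tau _ _]free_lift_delta.
by rewrite [cell_d _ _]free_lift_delta -surjective_pairing.
Qed.

Lemma cell_liftP g k :
  dif X (k + 1) (cell_lift g (k + 1 + 1)) = cell_ext (cell_bd g (k + 1)) /\
  chain_fun q (k + 1 + 1) (cell_lift g (k + 1 + 1)) =
    chain_fun v (k + 1 + 1) (0, delta g).
Proof.
elim/cell_nested_ind: g k => n a s y IH k.
(* With [n = j + 1], the cells of [s] are lifted in degree [j + 1 + 1], where the induction
   hypothesis is available. *)
have [j nj] := int_succ n; subst n; set g := Cell a s y.
have [x [xd xq]] : exists x, dif X (k + 1) x = cell_ext (cell_bd g (k + 1)) /\
    chain_fun q (k + 1 + 1) x = chain_fun v (k + 1 + 1) (0, delta g).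
  have [[adm jk]|h] := pselect (admissible a (combination s) y /\ j + 1 = k); last first.
    have bd0 : cell_bd g (k + 1) = 0 by have [] := cell_inadmissible h.
    have e0 : cell_ext (cell_bd g (k + 1)) = 0.
      by rewrite bd0 /cell_ext /= !linear0 addr0.
    rewrite e0; apply: (sphere_lifting_cycle lq).
    by rewrite chain_dif twist_delta_d bd0 linear0.
  subst k; have [bd _] := cell_admissible adm; rewrite bd.
  have extE : cell_ext (a, combination s) =
      chain_fun u _ a + \sum_(w <- s) w.1 *: cell_lift w.2 (j + 1 + 1).
    by rewrite /cell_ext [cell_lift_map _ _]free_lift_combination.
  (* The required boundary is a cycle by the induction hypothesis and the first two admissibility
     conditions. Its image under [q] is the boundary of [v (0, delta g)], as seen on [a] and on each
     cell of [s] separately. *)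
  apply: lq; rewrite extE.
    rewrite linearD linear_sum chain_dif /=.
    under eq_big_seq => w ws do rewrite linearZ /= (proj1 (IH w ws j)) /cell_ext scalerDr.
    rewrite big_split /=.
    under eq_bigr do rewrite -linearZ.
    under [X in _ + (_ + X)]eq_bigr do rewrite -linearZ.
    rewrite -!linear_sum addrA -linearD.
    case: adm; rewrite [cell_tau _ _]free_lift_combination.
    by rewrite [cell_d _ _]free_lift_combination => -> -> _; rewrite !linear0 addr0.
  rewrite chain_dif twist_delta_d bd linearD linear_sum.
  have -> : (a, combination s) = (a, 0) + \sum_(w <- s) w.1 *: (0, delta w.2) :>
      twist_obj cell_twisting (j + 1 + 1).
    have := linear_sum (@twist_inr _ _ cell_twisting (j + 1 + 1)) s xpredT
      (fun w => w.1 *: delta w.2).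
    under [RHS]eq_bigr do rewrite linearZ.
    move=> <-; apply: injective_projections; rewrite /= ?addr0 ?add0r //.
  have qu : chain_fun q (j + 1 + 1) (chain_fun u (j + 1 + 1) a) =
    chain_fun v (j + 1 + 1) (a, 0) := quv a.
  rewrite linearD linear_sum qu; congr (_ + _); rewrite big_seq [RHS]big_seq.
  apply: eq_bigr => w ws; rewrite !linearZ /=.
  by rewrite (proj2 (IH w ws j)).
(* A copy of the local [target] of [cell_lift], needed to state the specification of the [xget] in
   it. *)
pose target l : (X (l + 1) : lmodType R) :=
    chain_fun u (l + 1) (cell_bd g (l + 1)).1 +
    if `[< admissible a (combination s) y /\ j + 1 = l >]
    then \sum_(w <- [seq (u.1, cell_lift u.2) | u <- s]) w.1 *: w.2 (l + 1) else 0.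
have targetE l : target l = cell_ext (cell_bd g (l + 1)).
  rewrite /target /cell_ext; congr (_ + _); case: asboolP => [[adm <-]|h].
    have [-> _] := cell_admissible adm.
    by rewrite [RHS]free_lift_combination big_map.
  by have [-> _] := cell_inadmissible h; rewrite linear0.
have [lq' ld] : chain_fun q _ (cell_lift g (k + 1 + 1)) =
    chain_fun v (k + 1 + 1) (0, delta g) /\
    forall l (e : k + 1 + 1 = l + 1 + 1),
      dif X (l + 1) (ecast i (X i : lmodType R) e (cell_lift g (k + 1 + 1))) = target l.
  apply: (@xgetPex _ 0 [set x | chain_fun q _ x = chain_fun v _ (0, delta g) /\
    forall l (e : k + 1 + 1 = l + 1 + 1),
      dif X (l + 1) (ecast i (X i : lmodType R) e x) = target l]).
  exists x; split=> // l e; have kl : k = l by apply: addIr (1 : int) _ _ _; exact: addIr e.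
  by subst l; rewrite (eq_irrelevance e erefl) targetE.
by split=> //; rewrite -targetE -(ld _ erefl).
Qed.

Lemma cell_lift_map_d n x : dif X n (cell_lift_map (n + 1) x) =
  chain_fun u n (cell_tau n x) + cell_lift_map n (cell_d n x).
Proof.
have [m ->] := int_succ n.
apply: (@free_ext _ _ _ (dif X (m + 1) \o cell_lift_map (m + 1 + 1))
  ((chain_fun u (m + 1) \o cell_tau (m + 1)) \+
   (cell_lift_map (m + 1) \o cell_d (m + 1)))) => g.
rewrite /= [cell_lift_map (m + 1 + 1) _]free_lift_delta.
rewrite [cell_tau _ _]free_lift_delta [cell_d _ _]free_lift_delta.
by have [-> _] := cell_liftP g m.
Qed.

Lemma cell_lifting : exists h : hom (twist cell_twisting) X,
  h \oc twist_in cell_twisting ~= u /\ q \oc h ~= v.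
Proof.
exists (@twist_map _ A cell_twisting X u cell_lift_map cell_lift_map_d).
split; first exact: twist_map_in.
apply: twist_ext.
  rewrite -compmA twist_map_in; exact: quv.
move=> n x; have [j ->] := int_succ n; have [k ->] := int_succ j.
rewrite chain_compE twist_mapE linear0 add0r.
pose inr : {linear freemod R cell -> (twist cell_twisting (k + 1 + 1) : lmodType R)} :=
  (@twist_inr _ _ cell_twisting (k + 1 + 1) :
     {linear tw_obj cell_twisting (k + 1 + 1) -> twist_obj cell_twisting (k + 1 + 1)}).
apply: (@free_ext _ _ _ (chain_fun q (k + 1 + 1) \o cell_lift_map (k + 1 + 1))
  (chain_fun v (k + 1 + 1) \o inr)) => g.
rewrite /= [cell_lift_map (k + 1 + 1) _]free_lift_delta.
by have [_ ->] := cell_liftP g k.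
Qed.

End CellLift.

Lemma cell_factorization : exists (T : twisting A) (g : hom (twist T) B),
  [/\ free_twisting T, sphere_lifting g, g \oc twist_in T ~= f &
      forall X Y (q : hom X Y), sphere_lifting q -> has_lifting (twist_in T) q].
Proof.
exists cell_twisting, cell_fib; split.
- by move=> n; exists cell.
- exact: cell_fib_lifting.
- exact: twist_map_in.
- by move=> X Y q lq u v quv; exact: cell_lifting.
Qed.

End CellFactorization.

(** * Attaching free discs *)

Section DiscFactorization.
Variables (R : pzRingType) (A B : Ch (Mod R)) (f : hom A B).

(** In degree [n], [inl y] is the top cell of the disc attached for [y], and [inr y] is the boundary
    of such a top cell of degree [n + 1]. *)
Definition disc_cell (n : int) : choiceType :=
  ((B n : lmodType R) + (B (n + 1)%R : lmodType R))%type.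

Definition disc_d n : freemod R (disc_cell (n + 1)) -> freemod R (disc_cell n) :=
  free_lift (fun c => match c with inl y => delta (inr y) | inr _ => 0 end).

Definition disc_contraction n :
    freemod R (disc_cell n) -> freemod R (disc_cell (n + 1)) :=
  free_lift (fun c => match c with inl _ => 0 | inr y => delta (inl y) end).

(** [phi] is an arbitrary family of functions: a chain map out of free discs is given freely on top
    cells and forced on their boundaries. *)
Definition disc_val (X : Ch (Mod R)) (phi : forall n, (B n : lmodType R) -> (X n : lmodType R))
    n : freemod R (disc_cell n) -> (X n : lmodType R) :=
  free_lift (fun c => match c with inl y => phi n y | inr y => dif X n (phi (n + 1) y) end).

HB.instance Definition _ n := GRing.Linear.copy (@disc_d n) (free_lift _).
HB.instance Definition _ n := GRing.Linear.copy (@disc_contraction n) (free_lift _).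
HB.instance Definition _ X phi n := GRing.Linear.copy (@disc_val X phi n) (free_lift _).

Lemma disc_dd n x : @disc_d n (disc_d x) = 0.
Proof.
apply: (@free_ext _ _ _ (@disc_d n \o @disc_d (n + 1)) \0) => -[y|y];
  by rewrite /= [disc_d (delta _)]free_lift_delta ?linear0 // [LHS]free_lift_delta.
Qed.

Lemma disc_contractionP n x :
  disc_d (disc_contraction x) + @disc_contraction n (disc_d x) = x.
Proof.
apply: (@free_ext _ _ _ ((@disc_d _ \o @disc_contraction (n + 1)) \+
  (@disc_contraction n \o @disc_d n)) idfun) => -[y|y];
  rewrite /= [disc_d (delta _)]free_lift_delta [disc_contraction (delta _)]free_lift_delta.
  by rewrite linear0 add0r [LHS]free_lift_delta.
by rewrite linear0 addr0 [LHS]free_lift_delta.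
Qed.

Lemma disc_tau_d n (x : freemod R (disc_cell (n + 1 + 1))) :
  dif A n ((\0 : {linear freemod R (disc_cell (n + 1 + 1)) -> (A (n + 1) : lmodType R)}) x) +
  (\0 : {linear freemod R (disc_cell (n + 1)) -> (A n : lmodType R)}) (disc_d x) = 0.
Proof. by rewrite /= linear0 addr0. Qed.

Definition disc_twisting : twisting A :=
  @Twisting _ A (fun n => freemod R (disc_cell n)) (fun n => \0) disc_d
    disc_tau_d disc_dd.

Lemma disc_val_d (X : Ch (Mod R)) phi (u : hom A X) n (x : freemod R (disc_cell (n + 1))) :
  dif X n (disc_val phi x) =
  chain_fun u n ((\0 : {linear freemod R (disc_cell (n + 1)) -> (A n : lmodType R)}) x) +
  disc_val phi (disc_d x).
Proof.
rewrite /= linear0 add0r.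
apply: (@free_ext _ _ _ (dif X n \o disc_val phi (n := n + 1))
  (disc_val phi (n := n) \o @disc_d n)) => -[y|y];
  rewrite /= [disc_val _ (delta _)]free_lift_delta [disc_d (delta _)]free_lift_delta.
  by rewrite [RHS]free_lift_delta.
by rewrite linear0 dif_dif.
Qed.

Definition disc_map (X : Ch (Mod R)) phi (u : hom A X) : hom (twist disc_twisting) X :=
  @twist_map _ A disc_twisting X u (@disc_val X phi) (disc_val_d phi u).

Lemma disc_lifting (X Y : Ch (Mod R)) (q : hom X Y) :
  surjection q -> has_lifting (twist_in disc_twisting) q.
Proof.
move=> sq u v quv.
have qs n (y : (B n : lmodType R)) :
    {x | chain_fun q n x = chain_fun v n (0, delta (inl y))} by exact/cid/sq.
pose phi n y := projT1 (qs n y).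
exists (disc_map phi u); split; first exact: twist_map_in.
apply: twist_ext; first by rewrite -compmA twist_map_in; exact: quv.
move=> n x; rewrite chain_compE twist_mapE linear0 add0r.
pose inr' : {linear freemod R (disc_cell n) -> (twist disc_twisting n : lmodType R)} :=
  (@twist_inr _ _ disc_twisting n :
     {linear tw_obj disc_twisting n -> twist_obj disc_twisting n}).
apply: (@free_ext _ _ _ (chain_fun q n \o disc_val phi (n := n))
  (chain_fun v n \o inr')) => -[y|y];
  rewrite /= [disc_val _ _]free_lift_delta.
  by rewrite /phi; case: (qs n y).
rewrite -chain_dif /phi; case: (qs (n + 1) y) => z /= ->.
rewrite (@chain_dif _ _ _ v n (0, delta (inl y))) twist_dE !linear0 add0r; congr (chain_fun v n _).
by congr pair; exact: free_lift_delta.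
Qed.

(** The discs form a contractible direct summand: a cycle [x] among them is the boundary of
    [disc_contraction x]. *)
Lemma disc_quasi_iso : quasi_iso (twist_in disc_twisting).
Proof.
apply/quasi_isoP => n; split=> [z zc [[a x] e]|[a x] wc].
  by exists a; have := congr1 fst e; rewrite twist_dE /= addr0.
have := wc; rewrite /cycle twist_dE /= addr0 => e.
have ac : dif A n a = 0 := congr1 fst e.
have xc : disc_d x = 0 := congr1 snd e.
exists a => //; exists (0, - disc_contraction x).
rewrite twist_dE twist_inE /= !linear0 addr0.
apply: injective_projections; rewrite /= ?subrr //.
by rewrite linearN sub0r -[in LHS](disc_contractionP x) xc linear0 addr0.
Qed.

Lemma disc_factorization : exists (T : twisting A) (g : hom (twist T) B),
  [/\ free_twisting T, surjection g, quasi_iso (twist_in T), g \oc twist_in T ~= f &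
      forall X Y (q : hom X Y), surjection q -> has_lifting (twist_in T) q].
Proof.
exists disc_twisting, (disc_map (fun n y => y) f); split.
- by move=> n; exists (disc_cell n).
- move=> n y; exists (0, delta (inl y)).
  by rewrite twist_mapE linear0 add0r [LHS]free_lift_delta.
- exact: disc_quasi_iso.
- exact: twist_map_in.
- by move=> X Y q sq; exact: disc_lifting.
Qed.

End DiscFactorization.

Local Open Scope cat_scope.

(** * Transfer of the projective model structure *)

Section Transfer.
Variables (R : pzRingType) (D : category) (U : functor D (Ch (Mod R))).

(* The pushout along the counit of the image under the left adjoint of a
   relative free extension of [U V]. *)
Hypothesis attach : forall (V : D) (T : twisting (U V)), free_twisting T ->
  exists (Z : D) (i : hom V Z) (kappa : hom (twist T) (U Z)),
  [/\ kappa \oc twist_in T ~= fmap U i, quasi_iso kappa,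
      forall W (f : hom V W) (g : hom (twist T) (U W)),
        g \oc twist_in T ~= fmap U f ->
        exists h : hom Z W, h \oc i ~= f /\ fmap U h \oc kappa ~= g &
      forall W (h h' : hom Z W), h \oc i ~= h' \oc i ->
        fmap U h \oc kappa ~= fmap U h' \oc kappa -> h ~= h'].

Let W : mor_class D := fun x y f => quasi_iso (fmap U f).
Let Fb : mor_class D := fun x y f => surjection (fmap U f).

(** Since [kappa] is a quasi-isomorphism, weak equivalences pass between the two factorizations by
    two-out-of-three; lifts are produced and checked by the universal property of [Z]. *)
Lemma attach_factorization V Y (f : hom V Y) (T : twisting (U V))
    (g : hom (twist T) (U Y)) :
  free_twisting T -> g \oc twist_in T ~= fmap U f ->
  exists (Z : D) (i : hom V Z) (h : hom Z Y),
  [/\ h \oc i ~= f, quasi_iso g -> W h, surjection g -> Fb h,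
      quasi_iso (twist_in T) -> W i &
      forall X X' (q : hom X X'),
        has_lifting (twist_in T) (fmap U q) -> has_lifting i q].
Proof.
move=> fT gf; have [Z [i [kappa [ki qk ext uniq]]]] := attach fT.
have [h [hi hk]] := ext _ f g gf; exists Z, i, h; split=> //.
- move=> qg; have [_ e _] := quasi_iso_two_of_three (fmap U h) kappa.
  by apply: e => //; exact: quasi_iso_heq (heq_sym hk) qg.
- move=> sg n y; have [x <-] := sg n y.
  by exists (chain_fun kappa n x); exact: (hk n x).
- move=> qi; apply: quasi_iso_heq ki _.
  by have [e _ _] := quasi_iso_two_of_three kappa (twist_in T); exact: e.
- move=> X X' q L u v quv.
  have [|l [li ql]] := L (fmap U u) (fmap U v \oc kappa).
    by rewrite -compmA ki -!fmapM quv.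
  have [m [mi mk]] := ext _ u l li; exists m; split=> //.
  apply: uniq; first by rewrite -compmA mi quv.
  by rewrite fmapM -compmA mk ql.
Qed.

Lemma transferred_model_structure : is_model_structure (model_of_fib W Fb).
Proof.
have [qi_heq qi_id qi_comp] := quasi_iso_subcategory R.
have [s_heq s_id s_comp] := surjection_subcategory R.
have fret x y x' y' (f : hom x y) (g : hom x' y') :
    is_retract f g -> is_retract (fmap U f) (fmap U g).
  move=> [s [r [s' [r' [rs rs' gs fr]]]]].
  exists (fmap U s), (fmap U r), (fmap U s'), (fmap U r').
  split; [by rewrite -fmapM rs fmap1|by rewrite -fmapM rs' fmap1| |].
    by rewrite -!fmapM gs.
  by rewrite -!fmapM fr.
apply: model_of_fib_structure.
- split=> [a b f g fg|a|a b c g f Wg Wf]; rewrite /W.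
  + by apply: qi_heq; rewrite fg.
  + by apply: qi_heq (qi_id _); rewrite fmap1.
  + by apply: qi_heq (qi_comp _ _ _ _ _ Wg Wf); rewrite fmapM.
- split=> [a b f g fg|a|a b c g f Wg Wf]; rewrite /Fb.
  + by apply: s_heq; rewrite fg.
  + by apply: s_heq (s_id _); rewrite fmap1.
  + by apply: s_heq (s_comp _ _ _ _ _ Wg Wf); rewrite fmapM.
- move=> a b c g f; have [h1 h2 h3] := quasi_iso_two_of_three (fmap U g) (fmap U f).
  have gf := fmapM U g f; split=> [Wf Wg|Wf Wgf|Wg Wgf].
  + exact: qi_heq (heq_sym gf) (h1 Wf Wg).
  + exact: h2 Wf (qi_heq _ _ _ _ gf Wgf).
  + exact: h3 Wg (qi_heq _ _ _ _ gf Wgf).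
- by move=> a b x y f g /fret; exact: quasi_iso_retract.
- by move=> a b x y f g /fret; exact: surjection_retract.
- move=> a b f; have [T [g [fT lg gf lift]]] := cell_factorization (fmap U f).
  have [Z [i [h [hi qh sh _ L]]]] := attach_factorization fT gf.
  exists Z, i, h; split=> //.
    by move=> x y q sq qq; apply/L/lift; exact: sphere_lifting_triv_fib.
  by split; [apply/sh/sphere_lifting_surj|apply/qh/sphere_lifting_quasi_iso].
- move=> a b f; have [T [g [fT sg qi gf lift]]] := disc_factorization (fmap U f).
  have [Z [i [h [hi _ sh Wi L]]]] := attach_factorization fT gf.
  exists Z, i, h; split; [|exact: Wi|exact: sh|exact: hi].
  by move=> x y q sq; apply/L/lift.
Qed.

End Transfer.

(** Transfer along the identity functor, where the attached object is [twist T] itself. *)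
Lemma projective_model_structure (R : pzRingType) :
  is_model_structure (projective_model R).
Proof.
apply: (@transferred_model_structure R _ (idf (Ch (Mod R)))) => V T _.
exists (twist T), (twist_in T), (idm _); split=> [||Y f g gf|Y h h' _].
- exact: comp1m.
- exact: quasi_iso_id.
- by exists g; split=> //; exact: compm1.
- by move=> e; rewrite -(compm1 h) -(compm1 h').
Qed.

Local Open Scope ring_scope.

(** * Smooth representations *)

Section RepAttach.
Variables (k : fieldType) (p : nat) (G : topGroupType).
Variable I : open_pro_p_subgroup p G.
Notation H := (Hecke k I).

Definition pure (M : lmodType H) (x : X k I) (m : M) : tensor_rep M := tens [:: (x, m)].

Lemma inv_to_hom_unit (M : lmodType H) (m : M) x :
  inv_to_hom (tensor_unit m) x = pure x m.
Proof. exact: tensor_unit_hom. Qed.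

Lemma pureD_l (M : lmodType H) (x x' : X k I) (m : M) :
  pure (x + x') m = pure x m + pure x' m.
Proof. by rewrite -!inv_to_hom_unit linearD. Qed.

Lemma pure0_l (M : lmodType H) (m : M) : pure 0 m = 0.
Proof. by rewrite -inv_to_hom_unit linear0. Qed.

Lemma pureD_r (M : lmodType H) (x : X k I) (m m' : M) :
  pure x (m + m') = pure x m + pure x m'.
Proof. by rewrite /pure tensD; apply: tens_eq; exact: tens_addr. Qed.

Lemma pure_bal (M : lmodType H) (x : X k I) (h : H) (m : M) :
  pure (X_act x h) m = pure x (h *: m).
Proof. by apply: tens_eq; exact: tens_bal. Qed.

Lemma pure0_r (M : lmodType H) (x : X k I) : pure x (0 : M) = 0.
Proof. by rewrite -(scale0r (0 : M)) -pure_bal pure0_l. Qed.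

Lemma pure_ind (M : lmodType H) (P : tensor_rep M -> Prop) :
  P 0 -> (forall x m t, P t -> P (pure x m + t)) -> forall t, P t.
Proof.
move=> P0 Pc t; have [s ->] := tens_repr t.
by elim: s => [|[x m] s IH] //; rewrite tens_cons; exact: Pc.
Qed.

(** The representation is generated by the tensors [pure one_I m], because [one_I] generates [X]. *)
Lemma tensor_hom_ext (M : lmodType H) (W : smooth_rep k G)
    (f g : rep_hom (tensor_rep M) W) :
  (forall m, f (pure one_I m) = g (pure one_I m)) -> f =1 g.
Proof.
move=> fg; elim/pure_ind => [|x m t IH]; first by rewrite !linear0.
rewrite !linearD /= IH -inv_to_hom_unit; congr (_ + _).
apply: (@frob_unique _ _ _ _ _ (rep_comp f (inv_to_hom (tensor_unit m)))
  (rep_comp g (inv_to_hom (tensor_unit m)))).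
by rewrite /= [frob _ _](inv_to_hom_unit m); exact: fg.
Qed.

Definition transpose (M : lmodType H) (W : smooth_rep k G)
    (phi : {linear M -> invariants I W}) : rep_hom (tensor_rep M) W :=
  rep_comp (tensor_counit_hom I W) (tensor_hom phi).

Lemma transpose_pure (M : lmodType H) (W : smooth_rep k G)
    (phi : {linear M -> invariants I W}) x m :
  transpose phi (pure x m) = inv_to_hom (phi m) x.
Proof.
by rewrite /transpose /= tensor_mapE tensor_counitE /counit_seq big_seq1.
Qed.

Lemma transpose_one (M : lmodType H) (W : smooth_rep k G)
    (phi : {linear M -> invariants I W}) m :
  transpose phi (pure one_I m) = inv_val (phi m).
Proof. by rewrite transpose_pure inv_to_hom_one. Qed.

Lemma tensor_hom_pure (M N : lmodType H) (f : {linear M -> N}) x m :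
  tensor_hom f (pure x m) = pure x (f m).
Proof. exact: tensor_mapE. Qed.

Section UnitFree.
Variable S : choiceType.
Notation M := (freemod H S).

(** The coordinate [m s] in [H] viewed in the invariants of [X]. Its transpose projects the tensor
    product, a sum of copies of [X], to the copy indexed by [s]. *)
Definition coord_inv (s : S) (m : M) : invariants I (X k I) :=
  hom_to_inv (m s : endX k I).

Lemma coord_inv_linear s : linear (coord_inv s).
Proof.
move=> h m m'; apply: val_inj.
change ((m s : endX k I) ((h : endX k I) one_I) + (m' s : endX k I) one_I =
  inv_to_hom (hom_to_inv (m s : endX k I)) ((h : endX k I) one_I) +
  (m' s : endX k I) one_I).
by rewrite hom_to_invK.
Qed.

HB.instance Definition _ s := GRing.isLinear.Build H M (invariants I (X k I)) _
  (coord_inv s) (coord_inv_linear s).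

Definition tensor_coord (s : S) : rep_hom (tensor_rep M) (X k I) :=
  transpose (coord_inv s).

Lemma tensor_coord_pure s x m : tensor_coord s (pure x m) = X_act x (m s).
Proof. by rewrite /tensor_coord transpose_pure hom_to_invK. Qed.

Lemma tensor_free_decomp (t : tensor_rep M) : exists L0 : seq S,
  forall L, uniq L -> {subset L0 <= L} ->
    t = \sum_(c <- L) pure (tensor_coord c t) (delta c).
Proof.
elim/pure_ind: t => [|x m t [L0 tE]].
  exists [::] => L _ _; rewrite big1 // => c _; by rewrite linear0 pure0_l.
have [s [us ms]] := free_support m.
exists (s ++ L0) => L uL sL.
have mL c : m c != 0 -> c \in L by move=> /ms cs; apply: sL; rewrite mem_cat cs.
have L0L : {subset L0 <= L} by move=> c cL0; apply: sL; rewrite mem_cat cL0 orbT.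
under eq_bigr do rewrite linearD pureD_l.
rewrite big_split /= -tE //; congr (_ + _).
rewrite {1}(freemod_sum uL mL).
rewrite (big_morph (pure x) (pureD_r x) (pure0_r _ x)).
apply: eq_bigr => c _; rewrite -pure_bal; congr pure.
exact/esym/tensor_coord_pure.
Qed.

Lemma tensor_unit_free_bij : bijective (tensor_unit (I := I) (M := M)).
Proof.
have inj : injective (tensor_unit (I := I) (M := M)).
  (* The unit at [m] has coordinates [(m s) one_I], and an endomorphism of [X] is determined by its
     value on [one_I]. *)
  move=> m m' /(congr1 val) /= mm'; apply: freemod_ext => s.
  apply: rep_hom_ext; apply: frob_unique.
  have := tensor_coord_pure s one_I m; have := tensor_coord_pure s one_I m'.
  by rewrite /pure mm' => -> /esym.
have surj (v : invariants I (tensor_rep M)) : exists m, tensor_unit m = v.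
  have [L0 vE] := tensor_free_decomp (inv_val v).
  (* Each coordinate of [v] is an invariant vector of [X]; Frobenius reciprocity turns it into an
     endomorphism, which is the coefficient sought. *)
  pose h c : H := inv_to_hom (inv_map (tensor_coord c) v).
  exists (\sum_(c <- undup L0) h c *: delta c); apply: val_inj.
  have sub : {subset L0 <= undup L0} by move=> c; rewrite mem_undup.
  rewrite [RHS](vE _ (undup_uniq _) sub) /=.
  change (pure one_I (\sum_(c <- undup L0) h c *: delta c) =
    \sum_(c <- undup L0) pure (tensor_coord c (inv_val v)) (delta c)).
  rewrite (big_morph (pure one_I) (pureD_r one_I) (pure0_r _ one_I)).
  apply: eq_bigr => c _; rewrite -pure_bal; congr pure.
  exact: inv_to_hom_one.
exists (fun v => projT1 (cid (surj v))) => [m|v]; last by case: (cid _).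
by apply: inj; case: (cid _).
Qed.

End UnitFree.
End RepAttach.

Local Open Scope classical_set_scope.

(** * Direct sums of smooth representations *)

Section RepSum.
Variables (k : fieldType) (G : topGroupType) (V W : smooth_rep k G).

Definition sum_act (g : G) (z : V * W) : V * W := (act g z.1, act g z.2).

Lemma sum_act_linear g : linear (sum_act g).
Proof.
by move=> a [v w] [v' w']; apply: injective_projections; exact: linearP.
Qed.

Lemma sum_act1 z : sum_act 1%g z = z.
Proof. by case: z => v w; rewrite /sum_act !act1. Qed.

Lemma sum_actM g h z : sum_act (g * h)%g z = sum_act g (sum_act h z).
Proof. by case: z => v w; rewrite /sum_act !actM. Qed.

Lemma sum_act_smooth z : topology_structure.open [set g | sum_act g z = z].
Proof.
case: z => v w; rewrite (_ : mkset _ = [set g | act g v = v] `&` [set g | act g w = w]).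
  by apply: topology_structure.openI; exact: act_smooth.
by apply/seteqP; split=> g; rewrite /sum_act /= => -[-> ->].
Qed.

Definition rep_sum : smooth_rep k G :=
  @SmoothRep k G (V * W)%type sum_act sum_act_linear sum_act1 sum_actM sum_act_smooth.

Lemma rep_inl_linear : linear (fun v : V => (v, 0) : rep_sum).
Proof. by move=> a u v; apply: injective_projections => //=; rewrite scaler0 addr0. Qed.

Lemma rep_inl_equiv g (v : V) : ((act g v, 0) : rep_sum) = act g ((v, 0) : rep_sum).
Proof. by rewrite [RHS]/act /= /sum_act linear0. Qed.

Definition rep_inl : rep_hom V rep_sum := RepHom rep_inl_linear rep_inl_equiv.

Lemma rep_inr_linear : linear (fun w : W => (0, w) : rep_sum).
Proof. by move=> a u v; apply: injective_projections => //=; rewrite scaler0 addr0. Qed.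

Lemma rep_inr_equiv g (w : W) : ((0, act g w) : rep_sum) = act g ((0, w) : rep_sum).
Proof. by rewrite [RHS]/act /= /sum_act linear0. Qed.

Definition rep_inr : rep_hom W rep_sum := RepHom rep_inr_linear rep_inr_equiv.

Section Rec.
Variables (Y : smooth_rep k G) (f : rep_hom V Y) (g : rep_hom W Y).

Definition rep_rec_fun (z : rep_sum) : Y := f z.1 + g z.2.

Lemma rep_rec_linear : linear rep_rec_fun.
Proof.
move=> a [v w] [v' w']; rewrite /rep_rec_fun /= !linearP /=.
by rewrite scalerDr addrACA.
Qed.

Lemma rep_rec_equiv h z : rep_rec_fun (act h z) = act h (rep_rec_fun z).
Proof. by rewrite /rep_rec_fun /= !rep_equiv [RHS]linearD. Qed.

Definition rep_rec : rep_hom rep_sum Y := RepHom rep_rec_linear rep_rec_equiv.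

Lemma rep_recE v w : rep_rec (v, w) = f v + g w. Proof. by []. Qed.
End Rec.

Lemma rep_sum_ext (Y : smooth_rep k G) (f g : rep_hom rep_sum Y) :
  (forall v, f (v, 0) = g (v, 0)) -> (forall w, f (0, w) = g (0, w)) -> f =1 g.
Proof.
move=> fg1 fg2 [v w].
have -> : (v, w) = (v, 0) + (0, w) :> rep_sum.
  by apply: injective_projections; rewrite /= ?addr0 ?add0r.
by rewrite !linearD /= fg1 fg2.
Qed.

End RepSum.

(** * Pushouts of free extensions along the counit *)

Section RepAttachComplex.
Variables (k : fieldType) (p : nat) (G : topGroupType).
Variable I : open_pro_p_subgroup p G.
Notation H := (Hecke k I).
Variables (V : Ch (Rep k G)) (T : twisting (U_Ch k I V)).
Notation P := (tw_obj T).

Definition rdif (W : Ch (Rep k G)) n : rep_hom (W (n + 1)) (W n) := cx_d W n.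
Definition rchain (W W' : Ch (Rep k G)) (f : hom W W') n : rep_hom (W n) (W' n) :=
  chain f n.

Lemma rdif_rdif (W : Ch (Rep k G)) n w : rdif W n (rdif W (n + 1) w) = 0.
Proof. exact: (cx_dd W n w). Qed.

Lemma rchain_rdif (W W' : Ch (Rep k G)) (f : hom W W') n w :
  rdif W' n (rchain f (n + 1) w) = rchain f n (rdif W n w).
Proof. exact: (chain_d f n w). Qed.

Lemma U_dif_val (W : Ch (Rep k G)) n (z : invariants I (W (n + 1))) :
  inv_val (dif (U_Ch k I W) n z) = rdif W n (inv_val z).
Proof. by []. Qed.

(** The pushout of [F (twist T)] along the counit at [V]: the summand [F (U V)] is replaced by [V],
    and the off-diagonal part of the differential by its transpose [ratt_tau]. *)
Definition ratt_obj n : smooth_rep k G := rep_sum (V n) (tensor_rep (P n)).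

Definition ratt_tau n : rep_hom (tensor_rep (P (n + 1))) (V n) :=
  @transpose k p G I (P (n + 1)) (V n) (tw_tau T n).

Definition ratt_d n : rep_hom (ratt_obj (n + 1)) (ratt_obj n) :=
  rep_rec (rep_comp (rep_inl _ _) (rdif V n))
    (rep_add (rep_comp (rep_inl _ _) (ratt_tau n))
       (rep_comp (rep_inr _ _) (tensor_hom (tw_d T n)))).

Lemma ratt_dE n v w :
  ratt_d n (v, w) = (rdif V n v + ratt_tau n w, tensor_hom (tw_d T n) w).
Proof.
by apply: injective_projections; rewrite /= ?addr0 ?add0r.
Qed.

Lemma ratt_dd n z : ratt_d n (ratt_d (n + 1) z) = 0.
Proof.
apply: (@rep_sum_ext _ _ _ _ _ (rep_comp (ratt_d n) (ratt_d (n + 1))) (rep_zero _ _)) => [v|].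
  change (ratt_d n (ratt_d (n + 1) (v, 0)) = 0).
  by rewrite (@ratt_dE (n + 1)) ratt_dE !linear0 !addr0 rdif_rdif.
move=> w; change (rep_comp (rep_comp (ratt_d n) (ratt_d (n + 1))) (rep_inr _ _) w =
  rep_zero (tensor_rep (P (n + 1 + 1))) (ratt_obj n) w).
apply: tensor_hom_ext => {w} m.
change (ratt_d n (ratt_d (n + 1) (0, pure one_I m)) = 0).
rewrite (@ratt_dE (n + 1)) ratt_dE linear0 add0r [ratt_tau (n + 1) _]transpose_one.
rewrite !tensor_hom_pure [ratt_tau n _]transpose_one tw_dd pure0_r.
have := congr1 val (tw_tau_d m).
move=> e; apply: injective_projections => //; exact: e.
Qed.

Definition rattach : Ch (Rep k G) := @Complex (Rep k G) ratt_obj ratt_d ratt_dd.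

Lemma ratt_in_d n v : ratt_d n (rep_inl _ _ v) = rep_inl _ _ (rdif V n v).
Proof.
by change (ratt_d n (v, 0) = (rdif V n v, 0)); rewrite ratt_dE !linear0 addr0.
Qed.

Definition ratt_in : hom V rattach :=
  @ChainMap (Rep k G) V rattach (fun n => rep_inl _ _) ratt_in_d.

Definition ratt_kappa_fun n (z : twist_obj T n) : invariants I (ratt_obj n) :=
  inv_map (rep_inl (V n) (tensor_rep (P n))) z.1 +
  inv_map (rep_inr (V n) (tensor_rep (P n))) (tensor_unit z.2).

Lemma ratt_kappa_linear n : linear (@ratt_kappa_fun n).
Proof.
move=> a [x y] [x' y']; rewrite /ratt_kappa_fun /= !linearP /=.
by rewrite scalerDr addrACA.
Qed.

HB.instance Definition _ n := GRing.isLinear.Build H (twist_obj T n)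
  (invariants I (ratt_obj n)) _ (@ratt_kappa_fun n) (@ratt_kappa_linear n).

Lemma ratt_kappa_val n a m :
  inv_val (@ratt_kappa_fun n (a, m)) = (inv_val a, pure one_I m).
Proof. by apply: injective_projections; rewrite /= ?addr0 ?add0r. Qed.

Lemma ratt_kappa_d n (z : (twist T (n + 1) : lmodType H)) :
  dif (U_Ch k I rattach) n (ratt_kappa_fun z) = ratt_kappa_fun (dif (twist T) n z).
Proof.
case: z => a m; apply: val_inj.
change (ratt_d n (inv_val (ratt_kappa_fun (a, m))) = inv_val (@ratt_kappa_fun n
  (dif (U_Ch k I V) n a + tw_tau T n m, tw_d T n m))).
by rewrite !ratt_kappa_val ratt_dE [ratt_tau n _]transpose_one tensor_hom_pure.
Qed.

Definition ratt_kappa : hom (twist T) (U_Ch k I rattach) :=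
  @ChainMap (Mod H) (twist T) (U_Ch k I rattach)
    (fun n => @ratt_kappa_fun n : {linear twist_obj T n -> invariants I (ratt_obj n)})
    ratt_kappa_d.

Lemma ratt_kappa_in : ratt_kappa \oc twist_in T ~= fmap (U_Ch k I) ratt_in.
Proof.
move=> n a; apply: val_inj.
change (inv_val (ratt_kappa_fun (a, 0)) = (inv_val a, 0)).
by rewrite ratt_kappa_val pure0_r.
Qed.

Lemma ratt_kappa_quasi_iso : free_twisting T -> quasi_iso ratt_kappa.
Proof.
move=> fT; apply: bijective_quasi_iso => n.
have [unit' unitK unitVK] : bijective (tensor_unit (I := I) (M := P n)).
  by have [S ->] := fT n; exact: tensor_unit_free_bij.
pose pr1 := rep_rec (rep_id (V n)) (rep_zero (tensor_rep (P n)) (V n)).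
pose pr2 := rep_rec (rep_zero (V n) (tensor_rep (P n))) (rep_id (tensor_rep (P n))).
(* The first component of an invariant vector lies in [U V] already; the second comes from [P n] by
   the inverse of the unit. *)
exists (fun z => (inv_map pr1 z, unit' (inv_map pr2 z))).
- move=> [a m]; apply: injective_projections => /=.
    apply: val_inj; change (pr1 (inv_val (ratt_kappa_fun (a, m))) = inv_val a).
    by rewrite ratt_kappa_val [LHS]rep_recE /= addr0.
  rewrite -[RHS]unitK; congr unit'; apply: val_inj.
  change (pr2 (inv_val (ratt_kappa_fun (a, m))) = pure one_I m).
  by rewrite ratt_kappa_val [LHS]rep_recE /= add0r.
- move=> z; apply: val_inj.
  change (inv_val (ratt_kappa_fun (inv_map pr1 z, unit' (inv_map pr2 z))) = inv_val z).
  rewrite ratt_kappa_val.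
  have -> : pure one_I (unit' (inv_map pr2 z)) = inv_val (inv_map pr2 z).
    by rewrite -[RHS]/(inv_val _) -[in RHS](unitVK (inv_map pr2 z)).
  change ((pr1 (inv_val z), pr2 (inv_val z)) = inv_val z).
  by case: (inv_val z) => v w; rewrite /pr1 /pr2 !rep_recE /= addr0 add0r.
Qed.

(** The map is [f] on [V] and the transpose of [g] on the free part. On the generators
    [pure one_I m], compatibility with differentials says that [g] is a chain map. *)
Lemma ratt_ext W (f : hom V W) (g : hom (twist T) (U_Ch k I W)) :
  g \oc twist_in T ~= fmap (U_Ch k I) f ->
  exists h : hom rattach W, h \oc ratt_in ~= f /\ fmap (U_Ch k I) h \oc ratt_kappa ~= g.
Proof.
move=> gf.
have gfE n a : inv_val (chain_fun g n (a, 0)) = rchain f n (inv_val a).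
  exact: (congr1 val (gf n a)).
pose phi n : {linear P n -> invariants I (W n)} := chain_fun g n \o
  (@twist_inr _ _ T n : {linear P n -> twist_obj T n}).
pose h n : rep_hom (ratt_obj n) (W n) := rep_rec (rchain f n) (transpose (phi n)).
have hE n v m : h n (v, pure one_I m) =
    rchain f n v + inv_val (chain_fun g n (0, m)).
  by rewrite /h rep_recE transpose_one.
have h0 n v : h n (v, 0) = rchain f n v by rewrite /h rep_recE linear0 addr0.
have hd n z : rdif W n (h (n + 1) z) = h n (ratt_d n z).
  apply: (@rep_sum_ext _ _ _ _ _ (rep_comp (rdif W n) (h (n + 1)))
    (rep_comp (h n) (ratt_d n))) => [v|w].
    change (rdif W n (h (n + 1) (v, 0)) = h n (ratt_d n (v, 0))).
    by rewrite ratt_dE !linear0 addr0 !h0 rchain_rdif.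
  change (rep_comp (rep_comp (rdif W n) (h (n + 1))) (rep_inr _ _) w =
    rep_comp (rep_comp (h n) (ratt_d n)) (rep_inr _ _) w).
  apply: tensor_hom_ext => {w} m.
  change (rdif W n (h (n + 1) (0, pure one_I m)) = h n (ratt_d n (0, pure one_I m))).
  rewrite ratt_dE linear0 add0r tensor_hom_pure [ratt_tau n _]transpose_one !hE.
  rewrite linear0 add0r -U_dif_val chain_dif twist_dE linear0 add0r -gfE.
  have -> : (tw_tau T n m, tw_d T n m) = (tw_tau T n m, 0) + (0, tw_d T n m) :> twist_obj T n.
    by apply: injective_projections; rewrite /= ?addr0 ?add0r.
  by rewrite linearD.
exists (@ChainMap (Rep k G) rattach W h hd); split=> [n v|n [a m]]; first exact: h0.
apply: val_inj; change (h n (inv_val (ratt_kappa_fun (a, m))) =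
  inv_val (chain_fun g n (a, m))).
rewrite ratt_kappa_val hE -gfE.
have -> : (a, m) = (a, 0) + (0, m) :> twist_obj T n.
  by apply: injective_projections; rewrite /= ?addr0 ?add0r.
by rewrite linearD.
Qed.

Lemma ratt_unique W (h h' : hom rattach W) : h \oc ratt_in ~= h' \oc ratt_in ->
  fmap (U_Ch k I) h \oc ratt_kappa ~= fmap (U_Ch k I) h' \oc ratt_kappa -> h ~= h'.
Proof.
move=> hi hk n; apply: (@rep_sum_ext _ _ _ _ _ (rchain h n) (rchain h' n)) => [v|w].
  exact: (hi n v).
change (rep_comp (rchain h n) (rep_inr _ _) w = rep_comp (rchain h' n) (rep_inr _ _) w).
apply: tensor_hom_ext => {w} m.
have /(congr1 val) := hk n (0, m).
change (rchain h n (inv_val (ratt_kappa_fun (0, m))) =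
  rchain h' n (inv_val (ratt_kappa_fun (0, m))) -> 
  rchain h n (0, pure one_I m) = rchain h' n (0, pure one_I m)).
by rewrite ratt_kappa_val.
Qed.

End RepAttachComplex.

Lemma I_projective_model_structure (k : fieldType) (p : nat) (G : topGroupType)
    (I : open_pro_p_subgroup p G) :
  is_model_structure (I_projective_model k I).
Proof.
apply: transferred_model_structure => V T fT.
exists (rattach T), (ratt_in T), (ratt_kappa T); split.
- exact: ratt_kappa_in.
- exact: ratt_kappa_quasi_iso.
- by move=> W f g; exact: ratt_ext.
- by move=> W h h'; exact: ratt_unique.
Qed.

(** * Projective complexes, resolutions and cylinders *)

Section Cofibrant.
Variable R : pzRingType.
Implicit Types M N X Y : Ch (Mod R).

(** The part of cofibrancy used below, phrased without an initial object. *)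
Definition projective_complex M : Prop :=
  forall X Y (q : hom X Y), surjection q -> quasi_iso q ->
  forall v : hom M Y, exists h : hom M X, q \oc h ~= v.

Lemma cofibrant_projective M : cofibrant (projective_model R) M -> projective_complex M.
Proof.
move=> [o [i [oI Ci]]] X Y q sq qq v; have [u uP] := oI X; have [w wP] := oI Y.
have [|h [_ qh]] := Ci _ _ q sq qq u v; last by exists h.
by apply: heq_trans (wP _) (heq_sym (wP _)).
Qed.

Lemma free_resolution M : exists (T : twisting (zero_complex R)) (q : hom (twist T) M),
  [/\ free_twisting T, sphere_lifting q & projective_complex (twist T)].
Proof.
have [T [q [fT lq _ L]]] := cell_factorization (zero_complex_rec M).
exists T, q; split=> // X Y q' sq' qq' v.
have [|h [_ qh]] := L _ _ q' (sphere_lifting_triv_fib sq' qq') (zero_complex_rec X) v.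
  have [w wP] := @zero_complex_initial R Y.
  exact: heq_trans (wP _) (heq_sym (wP _)).
by exists h.
Qed.

(* Attaching cells to [M (+) M] so as to resolve the folding map. *)
Lemma cylinder M : projective_complex M ->
  exists (C : Ch (Mod R)) (i0 i1 : hom M C) (c : hom C M),
  [/\ projective_complex C, quasi_iso c, c \oc i0 ~= idm M, c \oc i1 ~= idm M &
      forall X Y (q : hom X Y) (g g' : hom M X), sphere_lifting q ->
        q \oc g ~= q \oc g' -> exists h : hom C X, h \oc i0 ~= g /\ h \oc i1 ~= g'].
Proof.
move=> pM; have [T [c [_ lc ci L]]] := cell_factorization (dsum_rec (idm M) (idm M)).
exists (twist T), (twist_in T \oc dsum_inl M M), (twist_in T \oc dsum_inr M M), c; split.
- move=> X Y q sq qq v.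
  (* Lift first on the two copies of [M], then extend over the attached cells. *)
  have [h1 h1P] := pM _ _ q sq qq (v \oc (twist_in T \oc dsum_inl M M)).
  have [h2 h2P] := pM _ _ q sq qq (v \oc (twist_in T \oc dsum_inr M M)).
  have [|h [_ qh]] := L _ _ q (sphere_lifting_triv_fib sq qq) (dsum_rec h1 h2) v.
    by apply: dsum_ext; rewrite -!compmA ?dsum_rec_inl ?dsum_rec_inr.
  by exists h.
- exact: sphere_lifting_quasi_iso.
- by rewrite compmA ci dsum_rec_inl.
- by rewrite compmA ci dsum_rec_inr.
- move=> X Y q g g' lq qgg'.
  (* The map below is the constant homotopy at [q \oc g]; it matches [g'] on the second copy since
     [q \oc g ~= q \oc g']. *)
  have [|h [hi _]] := L _ _ q lq (dsum_rec g g') (q \oc g \oc c).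
    rewrite -[X in _ ~= X]compmA ci; apply: dsum_ext.
      by rewrite -!compmA !dsum_rec_inl compm1.
    by rewrite -!compmA !dsum_rec_inr compm1 qgg'.
  by exists h; rewrite !compmA hi dsum_rec_inl dsum_rec_inr.
Qed.

End Cofibrant.

(** * The Quillen equivalence and the derived equivalence *)

Section Main.
Variables (k : fieldType) (p : nat) (G : topGroupType).
Variable I : open_pro_p_subgroup p G.
Notation H := (Hecke k I).
Notation adj := (FU_adjunction k I).

Lemma tensor_unit_map (M N : lmodType H) (f : {linear M -> N}) m :
  inv_map (tensor_hom f) (tensor_unit m) = tensor_unit (f m) :> invariants I _.
Proof. apply: val_inj; exact: tensor_hom_pure. Qed.

Lemma tensor_unit_retract (M N : lmodType H) (s : {linear M -> N}) (r : {linear N -> M}) :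
  cancel s r -> bijective (tensor_unit (I := I) (M := N)) ->
  bijective (tensor_unit (I := I) (M := M)).
Proof.
move=> sr [unit' unitK unitVK].
have FsK : cancel (tensor_hom s : tensor_rep M -> tensor_rep N) (tensor_hom r).
  move=> t; apply: (@tensor_hom_ext _ _ _ _ _ _ (rep_comp (tensor_hom r) (tensor_hom s))
    (rep_id _)) => m.
  by rewrite /= [tensor_map _ (pure _ _)]tensor_hom_pure [LHS]tensor_hom_pure sr.
exists (fun v => r (unit' (inv_map (tensor_hom s) v))) => [m|v].
  by rewrite tensor_unit_map unitK sr.
by rewrite -tensor_unit_map unitVK; apply: val_inj; exact: FsK.
Qed.

(** Lifting the identity through a free resolution makes [M] a retract of it, and bijectivity of the
    unit passes to retracts by naturality. *)
Lemma projective_unit_bij (M : Ch (Mod H)) n : projective_complex M ->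
  bijective (tensor_unit (I := I) (M := (M n : lmodType H))).
Proof.
move=> pM; have [T [q [fT lq _]]] := free_resolution M.
have [h qh] := pM _ _ q (sphere_lifting_surj lq) (sphere_lifting_quasi_iso lq) (idm M).
pose s : {linear (M n : lmodType H) -> tw_obj T n} :=
  (snd : {linear twist_obj T n -> tw_obj T n}) \o chain_fun h n.
pose r : {linear tw_obj T n -> (M n : lmodType H)} := chain_fun q n \o
  (@twist_inr _ _ T n : {linear tw_obj T n -> twist_obj T n}).
have sr : cancel s r.
  move=> m; transitivity (chain_fun q n (chain_fun h n m)); last exact: (qh n m).
  (* The component in the zero complex, dropped by [s], carries no information. *)
  congr (chain_fun q n _); rewrite /s /=.
  by case: (chain_fun h n m) => z x; congr pair; exact: zero_complex_el.
apply: tensor_unit_retract sr _.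
by have [S ->] := fT n; exact: tensor_unit_free_bij.
Qed.

Lemma projective_unit_weq (M : Ch (Mod H)) : projective_complex M ->
  quasi_iso (unit_ adj M).
Proof.
by move=> pM; apply: bijective_quasi_iso => n; exact: projective_unit_bij.
Qed.

(** Lifting properties pass through the adjunction; that [F] sends trivial cofibrations to weak
    equivalences then follows from [weq_of_lifting]. *)
Lemma I_projective_quillen_adjunction :
  is_quillen_adjunction (projective_model H) (I_projective_model k I) (F_Ch k I).
Proof.
have MS := projective_model_structure H; have MS' := I_projective_model_structure k I.
have Fcof M N (f : hom M N) : cof (projective_model H) f ->
    cof (I_projective_model k I) (fmap (F_Ch k I) f).
  by move=> Cf X Y q sq qq; apply: (adj_lifting adj); exact: Cf.
split=> // M N f [Cf Wf]; split; first exact: Fcof.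
apply: weq_of_lifting MS' _ => X Y q sq; apply: (adj_lifting adj).
exact: (ms_lift_triv_cof MS).
Qed.

Lemma I_projective_quillen_equivalence :
  is_quillen_equivalence (projective_model H) (I_projective_model k I) adj.
Proof.
split; first exact: I_projective_quillen_adjunction.
move=> M V f /cofibrant_projective/projective_unit_weq Wu _.
have [h1 h2 _] := quasi_iso_two_of_three (fmap (U_Ch k I) f) (unit_ adj M).
by split; [exact: h1|exact: h2].
Qed.

Definition resolution (M : Ch (Mod H)) : Ch (Mod H) := twist (projT1 (cid (free_resolution M))).

Definition resolution_map (M : Ch (Mod H)) : hom (resolution M) M :=
  projT1 (cid (projT2 (cid (free_resolution M)))).

Lemma resolutionP (M : Ch (Mod H)) :
  sphere_lifting (resolution_map M) /\ projective_complex (resolution M).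
Proof.
by case: (projT2 (cid (projT2 (cid (free_resolution M))))).
Qed.

Lemma resolution_weq (M : Ch (Mod H)) : quasi_iso (resolution_map M).
Proof. by apply: sphere_lifting_quasi_iso; case: (resolutionP M). Qed.

Lemma resolution_lift (M N : Ch (Mod H)) (v : hom M N) : projective_complex M ->
  exists h : hom M (resolution N), resolution_map N \oc h ~= v.
Proof.
move=> pM; have [lq _] := resolutionP N.
by apply: pM; [exact: sphere_lifting_surj|exact: sphere_lifting_quasi_iso].
Qed.

(** Both lifts factor through the cylinder as [h \oc i0] and [h \oc i1]. The ends [i0] and [i1] are
    sections of [c], and [F c] becomes invertible, so they are identified in the localization. *)
Lemma F_resolution_lift_unique (M N : Ch (Mod H)) (g g' : hom M (resolution N)) :
  projective_complex M -> resolution_map N \oc g ~= resolution_map N \oc g' ->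
  fmap (loc_functor (weq (I_projective_model k I))) (fmap (F_Ch k I) g) ~=
  fmap (loc_functor (weq (I_projective_model k I))) (fmap (F_Ch k I) g').
Proof.
move=> pM qgg'; have [C [i0 [i1 [c [pC wc ci0 ci1 ext]]]]] := cylinder pM.
have [h [hi0 hi1]] := ext _ _ _ g g' (proj1 (resolutionP N)) qgg'.
rewrite -hi0 -hi1 !fmapM; apply: compm_heq => //.
have Wc : weq (I_projective_model k I) (fmap (F_Ch k I) c).
  apply: (@weq_F _ _ (projective_model H) _ _ _ adj (@projective_complex H)) => //.
  - exact: quasi_iso_two_of_three.
  - exact: quasi_iso_subcategory.
  - exact: projective_unit_weq.
apply: (iso_mono (loc_iso Wc)).
by rewrite -!fmapM ci0 ci1.
Qed.

End Main.

Theorem proposition2p14 (k : fieldType) (p : nat) (hp : p \in [pchar k])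
    (G : topGroupType) (I : open_pro_p_subgroup p G) :
  is_quillen_equivalence (projective_model (Hecke k I)) (I_projective_model k I)
    (FU_adjunction k I) /\
  exists DA : derived_adjunction (projective_model (Hecke k I))
                (I_projective_model k I) (FU_adjunction k I),
    @is_equivalence (derived_category (Hecke k I)) (Ho (I_projective_model k I))
      (LF DA) (RU DA) (LF_RU_adj DA).
Proof.
split; first exact: I_projective_quillen_equivalence.
(* Unification supplies [derived_pair] for the free resolutions as the derived adjunction. *)
eexists; apply: (@derived_pair_equivalence _ _ (projective_model (Hecke k I))
  (I_projective_model k I) _ _ (FU_adjunction k I) (@projective_complex _)
  (@resolution k p G I) (@resolution_map k p G I)).
- by move=> M; case: (resolutionP M).
- exact: resolution_weq.
- by move=> M N v; exact: resolution_lift.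
- exact: quasi_iso_two_of_three.
- exact: quasi_iso_subcategory.
- by [].
- exact: projective_unit_weq.
- by move=> M N g g'; exact: F_resolution_lift_unique.
Qed.
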